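(* Let $U \in \mathrm{op}(X_{sa})$ and $V \in \mathrm{op}(S)$. The category of c-soft sheaves on $X_{sa}\times S$ is injective with respect to the functor $\Gamma(U \times V; \bullet)$ on $\mathrm{Mod}(\mathbb{C}_{X_{sa}\times S})$.
   Context: $X$ and $S$ are real analytic manifolds. $\mathrm{op}(S)$ is the category of open subsets of $S$ and $\mathrm{op}(X_{sa})$ the category of open subanalytic subsets of $X$; in the subanalytic site $X_{sa}$ a family $\Sigma \subset \mathrm{op}(X_{sa})$ is a covering of $U$ if for every compact $K\subset X$ there is a finite $\Sigma_0\subset \Sigma$ with $K\cap\bigcup_{V\in \Sigma_0}V=K\cap U$. The site $X_{sa}\times S$: open sets are finite unions of products $U\times V$ with $U\in \mathrm{op}(X_{sa})$, $V\in \mathrm{op}(S)$. A family is a covering of $U\times V$ iff it admits a refinement $\{U_i\times V_j\}_{i\in I,j\in J}$ with $\{U_i\}_{i\in I}$ a covering of $U$ in $X_{sa}$ and $\{V_j\}_{j\in J}$ an open covering of $V$; a family $T$ covers a general $W$ if for each product $U\times V\subset W$ the restriction of $T$ to $U\times V$ is a covering of $U\times V$. For $W\subset W'$ in $\mathrm{op}(X_{sa}\times S)$ one says that $W$ is weakly quasi-compact in $W'$, written $W\overset{wc}{\to}W'$, if for every covering of $W'$ its restriction to $W$ admits a finite refinement. Explicitly, if $W=\bigcup_{j\in J}(U_j\times V_j)$ with $J$ finite, then $W\overset{wc}{\to}W'$ if $U_j$, $V_j$ are relatively compact and $U_j\times\overline{V_j}\subset W'$ for every $j\in J$. A sheaf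 $F$ on $X_{sa}\times S$ is c-soft if the restriction morphism $\Gamma(W;F)\to\varinjlim_{V\overset{wc}{\to}U}\Gamma(U;F)$ (limit over the open sets $U$ of the site with $V\overset{wc}{\to}U$) is surjective whenever $V,W,Y\in\mathrm{op}(X_{sa}\times S)$ with $V,W\subset Y$ satisfy $V\overset{wc}{\to}Y$, $W\overset{wc}{\to}Y$ and $V\overset{wc}{\to}W$. A full subcategory $\mathcal{J}$ of an abelian category $\mathcal{A}$ is injective with respect to a left exact functor $\Phi$ if (standard notion): every object of $\mathcal{A}$ embeds into an object of $\mathcal{J}$; if $0\to F'\to F\to F''\to 0$ is exact with $F',F\in\mathcal{J}$ then $F''\in\mathcal{J}$; and for such a sequence with $F',F,F''\in \mathcal{J}$ the sequence $0\to\Phi(F')\to\Phi(F)\to\Phi(F'')\to0$ is exact. *)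

(* Defs.v *)
From HB Require Import structures.
From mathcomp Require Import all_boot all_order all_algebra.
From mathcomp Require Import complex.
From mathcomp Require Import all_classical all_reals all_analysis.
From mathcomp Require Import showcase.summability.

Set Implicit Arguments.
Unset Strict Implicit.
Unset Printing Implicit Defensive.

Import Order.TTheory GRing.Theory Num.Theory.
Import numFieldNormedType.Exports.

Local Open Scope classical_set_scope.
Local Open Scope ring_scope.

(* Real analytic functions on R^n: near the point, the function is the sum of
   a power series over multi-indices.  Convergence along [totally] is
   unconditional, hence absolute, convergence. *)

Definition monomial (R : realType) (n : nat) (x : 'rV[R]_n)
    (al : {ffun 'I_n -> nat}) : R :=
  \prod_(i < n) x 0 i ^+ al i.

Definition analytic_at (R : realType) (n : nat) (f : 'rV[R]_n -> R)
    (a : 'rV[R]_n) : Prop :=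
  exists c : {ffun 'I_n -> nat} -> R,
    \forall x \near a,
      partial_sum (fun al => c al * monomial (x - a) al) @ totally --> f x.

Definition analytic_map_at (R : realType) (n m : nat)
    (f : 'rV[R]_n -> 'rV[R]_m) (a : 'rV[R]_n) : Prop :=
  forall j : 'I_m, analytic_at (fun x => f x 0 j) a.

(* Only the values of [chart_map] on [chart_dom], and those of [chart_inv] on
   the image of [chart_dom], are meaningful. *)
Record chart (R : realType) (X : topologicalType) := Chart {
  chart_dim : nat;
  chart_dom : set X;
  chart_map : X -> 'rV[R]_chart_dim;
  chart_inv : 'rV[R]_chart_dim -> X;
  chart_dom_open : open chart_dom;
  chart_im_open : open (chart_map @` chart_dom);
  chart_mapK : forall x, chart_dom x -> chart_inv (chart_map x) = x;
  chart_map_continuous :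
    forall x, chart_dom x -> {for x, continuous chart_map};
  chart_inv_continuous :
    forall x, chart_dom x -> {for chart_map x, continuous chart_inv} }.

Arguments chart_inv {R X} c _.

(* The dimension may vary between connected components; it is locally
   constant because the transition maps are analytic diffeomorphisms. *)
Record analyticManifold (R : realType) := AnalyticManifold {
  mfd_space :> topologicalType;
  mfd_hausdorff : hausdorff_space mfd_space;
  mfd_second_countable : @second_countable mfd_space;
  atlas : set (chart R mfd_space);
  atlas_cover : forall x, exists2 c, atlas c & chart_dom c x;
  atlas_compat : forall c c' x, atlas c -> atlas c' ->
    chart_dom c x -> chart_dom c' x ->
    analytic_map_at (chart_map c' \o chart_inv c) (chart_map c x) }.

Section Subanalytic.
Variables (R : realType) (X : analyticManifold R).

(* Coordinates on X * R^m given by a chart of X. *)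
Definition prod_coord (m : nat) (c : chart R X) (q : X * 'rV[R]_m) :
    'rV[R]_(chart_dim c + m) :=
  row_mx (chart_map c q.1) q.2.

(* Around every point of the ambient manifold (in the set or not), B is a
   finite union of finite intersections of sets {f > 0} and {f = 0}. *)
Definition semianalytic (m : nat) (B : set (X * 'rV[R]_m)) : Prop :=
  forall p : X * 'rV[R]_m,
  exists (c : chart R X) (V : set (X * 'rV[R]_m)) (k l : nat)
         (f : 'I_k -> 'I_l -> 'rV[R]_(chart_dim c + m) -> R)
         (strict : 'I_k -> 'I_l -> bool),
    [/\ atlas c,
        nbhs p V,
        (forall q, V q -> chart_dom c q.1),
        (forall q i j, V q -> analytic_at (f i j) (prod_coord c q)) &
        forall q, V q ->
          (B q <-> exists i, forall j,
             if strict i j then 0 < f i j (prod_coord c q)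
             else f i j (prod_coord c q) == 0)].

(* Locally on X, A is the projection of a relatively compact semianalytic
   subset of some X * R^m. *)
Definition subanalytic (A : set X) : Prop :=
  forall x : X, exists (V : set X) (m : nat) (B : set (X * 'rV[R]_m)),
    [/\ nbhs x V, semianalytic B, compact (closure B) & A `&` V = fst @` B].

Definition op_sa (U : set X) : Prop := open U /\ subanalytic U.

Definition sa_covering (Sg : set (set X)) (U : set X) : Prop :=
  (forall A, Sg A -> op_sa A /\ A `<=` U) /\
  forall K : set X, compact K ->
    exists Sg0 : set (set X),
      [/\ finite_set Sg0, Sg0 `<=` Sg & K `&` \bigcup_(A in Sg0) A = K `&` U].

End Subanalytic.

Definition open_covering (S : topologicalType) (Tt : set (set S)) (V : set S) :
    Prop :=
  Tt `<=` open /\ \bigcup_(B in Tt) B = V.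

Section Site.
Variables (R : realType) (X S : analyticManifold R).

Definition site_open (W : set (X * S)) : Prop :=
  exists (k : nat) (U : 'I_k -> set X) (V : 'I_k -> set S),
    (forall i, op_sa (U i) /\ open (V i)) /\
    W = \bigcup_i (U i `*` V i).

Record op := Op {
  op_set :> set (X * S);
  op_site_open : site_open op_set }.

Definition refines (T' T : set (set (X * S))) : Prop :=
  forall t', T' t' -> exists2 t, T t & t' `<=` t.

Definition restrict_family (T : set (set (X * S))) (W : set (X * S)) :
    set (set (X * S)) :=
  [set t `&` W | t in T].

Definition covering_prod (T : set (set (X * S))) (U : set X) (V : set S) :
    Prop :=
  exists (Sg : set (set X)) (Tt : set (set S)),
    [/\ sa_covering Sg U, open_covering Tt V &
        refines [set A `*` B | A in Sg & B in Tt] T].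

(* For W = U `*` V this is [covering_prod T U V], as the latter is stable under
   restriction to smaller products. *)
Definition covering (T : set (set (X * S))) (W : set (X * S)) : Prop :=
  (forall t, T t -> site_open t /\ t `<=` W) /\
  forall (U : set X) (V : set S), op_sa U -> open V -> U `*` V `<=` W ->
    covering_prod (restrict_family T (U `*` V)) U V.

(* Weak quasi-compactness of W in W'. *)
Definition wc (W W' : op) : Prop :=
  W `<=` W' /\
  forall T, covering T W' ->
    exists T', [/\ finite_set T', covering T' W &
                   refines T' (restrict_family T W)].

Lemma site_open_prod (U : set X) (V : set S) :
  op_sa U -> open V -> site_open (U `*` V).
Proof.
move=> hU hV; exists 1%N, (fun=> U), (fun=> V); split=> //.
by apply/seteqP; split=> [q Uq|q [i _ //]]; exists ord0.
Qed.

Definition op_prod (U : set X) (V : set S) (hU : op_sa U) (hV : open V) : op :=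
  Op (site_open_prod hU hV).

Record presheaf := Presheaf {
  sect :> op -> lmodType R[i];
  res : forall W W' : op, W' `<=` W -> {linear sect W -> sect W'};
  res_id : forall (W : op) (h : W `<=` W) s, res h s = s;
  res_comp : forall (W W' W'' : op)
      (h : W' `<=` W) (h' : W'' `<=` W') (h'' : W'' `<=` W) s,
    res h' (res h s) = res h'' s }.

(* Sections agree on V1 `&` V2 iff they agree on every open set of the site
   contained in it. *)
Definition compatible (F : presheaf) (T : set (set (X * S)))
    (s : forall V : op, T V -> F V) : Prop :=
  forall (V1 V2 : op) (t1 : T V1) (t2 : T V2) (V : op)
    (h1 : V `<=` V1) (h2 : V `<=` V2),
  res F h1 (s V1 t1) = res F h2 (s V2 t2).

Definition is_sheaf (F : presheaf) : Prop :=
  forall (W : op) (T : set (set (X * S))), covering T W ->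
  forall s : (forall V : op, T V -> F V), compatible s ->
  exists! w : F W, forall (V : op) (tV : T V) (h : V `<=` W),
    res F h w = s V tV.

Record sheaf := Sheaf {
  sheaf_presheaf :> presheaf;
  sheafP : is_sheaf sheaf_presheaf }.

Record sheafMor (F G : sheaf) := SheafMor {
  mor :> forall W : op, {linear F W -> G W};
  mor_natural : forall (W W' : op) (h : W' `<=` W) (s : F W),
    mor W' (res F h s) = res G h (mor W s) }.

Definition mor_eq (F G : sheaf) (f g : sheafMor F G) : Prop :=
  forall W s, f W s = g W s.

Definition mor_monic (F G : sheaf) (f : sheafMor F G) : Prop :=
  forall (H : sheaf) (a b : sheafMor H F),
    (forall W s, f W (a W s) = f W (b W s)) -> mor_eq a b.

Definition zero_comp (F' F F'' : sheaf) (f : sheafMor F' F)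
    (g : sheafMor F F'') : Prop :=
  forall W s, g W (f W s) = 0.

Definition is_kernel (F' F F'' : sheaf) (f : sheafMor F' F)
    (g : sheafMor F F'') : Prop :=
  zero_comp f g /\
  forall (H : sheaf) (h : sheafMor H F), zero_comp h g ->
    exists k : sheafMor H F',
      (forall W s, f W (k W s) = h W s) /\
      forall k' : sheafMor H F',
        (forall W s, f W (k' W s) = h W s) -> mor_eq k k'.

Definition is_cokernel (F' F F'' : sheaf) (f : sheafMor F' F)
    (g : sheafMor F F'') : Prop :=
  zero_comp f g /\
  forall (H : sheaf) (h : sheafMor F H), zero_comp f h ->
    exists k : sheafMor F'' H,
      (forall W s, k W (g W s) = h W s) /\
      forall k' : sheafMor F'' H,
        (forall W s, k' W (g W s) = h W s) -> mor_eq k k'.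

(* 0 -> F' -> F -> F'' -> 0 is exact in the category of sheaves; the cokernel
   is the sheaf one, so g need not be surjective on sections. *)
Definition short_exact (F' F F'' : sheaf) (f : sheafMor F' F)
    (g : sheafMor F F'') : Prop :=
  is_kernel f g /\ is_cokernel f g.

Definition lmod_short_exact (K : pzRingType) (M' M M'' : lmodType K)
    (u : {linear M' -> M}) (v : {linear M -> M''}) : Prop :=
  [/\ injective u, range u = [set m | v m = 0] & range v = setT].

(* The system {V wc U} being filtrant, t : F U and t' : F U' have the same
   image in its inductive limit iff they agree on some smaller U''. *)
Definition wc_germ_eq (F : presheaf) (V U U' : op) (t : F U) (t' : F U') :
    Prop :=
  exists (U'' : op) (h : U'' `<=` U) (h' : U'' `<=` U'),
    wc V U'' /\ res F h t = res F h' t'.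

Definition c_soft (F : sheaf) : Prop :=
  forall V W Y : op, V `<=` Y -> W `<=` Y -> wc V Y -> wc W Y -> wc V W ->
  forall (U : op) (t : F U), wc V U ->
    exists s : F W, wc_germ_eq V s t.

(* Phi, with its action PhiM on morphisms, is a functor from sheaves to
   complex vector spaces, and J is a full subcategory. *)
Definition injective_wrt (J : sheaf -> Prop) (Phi : sheaf -> lmodType R[i])
    (PhiM : forall F G : sheaf, sheafMor F G -> {linear Phi F -> Phi G}) :
    Prop :=
  [/\ (forall F, exists G (f : sheafMor F G), J G /\ mor_monic f),
      (forall F' F F'' (f : sheafMor F' F) (g : sheafMor F F''),
         short_exact f g -> J F' -> J F -> J F'') &
      (forall F' F F'' (f : sheafMor F' F) (g : sheafMor F F''),
         short_exact f g -> J F' -> J F -> J F'' ->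
         lmod_short_exact (PhiM _ _ f) (PhiM _ _ g))].

Definition Gamma (W : op) (F : sheaf) : lmodType R[i] := F W.

Definition GammaM (W : op) (F G : sheaf) (f : sheafMor F G) :
    {linear Gamma W F -> Gamma W G} := f W.

End Site.

(* Main.v *)
(* For a sequence 0 -> F' -> F -> F'' -> 0 with F' c-soft, a section of F''
   lifts to F near every weakly quasi-compact open set: local lifts exist on a
   finite cover, and two of them are glued after extending their difference,
   a section of F', by c-softness.  This gives the c-softness of F'' when F is
   c-soft.  Writing U x V as an increasing union of weakly quasi-compact open
   sets, each in the next, and correcting successive lifts by sections of F'
   (Mittag-Leffler), one lifts sections over U x V.

   The site has enough points: an ultrafilter on X containing a compact set
   together with a point of S.  Hence F embeds into the product of its stalks,
   which is flabby (extend by zero), so c-soft.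

   All this uses that subanalytic open sets are stable under finite
   intersections: locally, the fibre product over X of two semianalytic sets is
   semianalytic, which amounts to analyticity of changes of charts composed
   with analytic functions. *)
Require Import Defs.
From HB Require Import structures.
From mathcomp Require Import all_boot all_order all_algebra.
From mathcomp Require Import finmap complex.
From mathcomp Require Import all_classical all_reals all_analysis.
From mathcomp Require Import showcase.summability.
From mathcomp Require Import ring lra.

Set Implicit Arguments.
Unset Strict Implicit.
Unset Printing Implicit Defensive.

Import Order.TTheory GRing.Theory Num.Theory.
Import numFieldNormedType.Exports.

Local Open Scope classical_set_scope.
Local Open Scope ring_scope.

(* Exactness is given by universal properties, so it has to be tested against explicit sheaves: the
   kernel of [g], and the subsheaf of [F''] formed by the sections that lift locally. The obstacle
   is that coverings of the site do not compose, so lifting on the members of a covering is not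
   visibly a local condition. Lifting near every point is one. A point involves an ultrafilter on X,
   not an element of X, because a covering in X_sa is finite over each compact set: a compact member
   lets the ultrafilter select one of finitely many sets. Conversely, open sets of the site through
   all the points over a relatively compact A and a given v have a finite subfamily covering A x
   {v}. An open set of the site, being a finite union of rectangles, contains A x B for some
   neighbourhood B of v as soon as it contains A x {v}. These two facts replace compactness in the X
   direction; in the S direction ordinary compactness is used. *)
#[local] Existing Instance totally_filter.

(** * Unconditional sums *)

Section UnconditionalSums.
Variable R : realType.
Implicit Types I J K : choiceType.

Definition hasSum I (a : I -> R) (s : R) : Prop :=
  partial_sum a @ totally --> s.

(** This says that the l^1 norm of [a] is at most [M], before any sum is known to exist. *)
Definition absBound I (a : I -> R) (M : R) : Prop :=
  forall A : {fset I}, \sum_(i <- A) `|a i| <= M.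

Lemma partial_sumE I (a : I -> R) (A : {fset I}) :
  partial_sum a A = \sum_(i <- A) a i.
Proof. by rewrite /partial_sum big_seq_fsetE. Qed.

Lemma hasSumP I (a : I -> R) (s : R) :
  hasSum a s <-> forall e, 0 < e -> exists A : {fset I},
    forall B : {fset I}, (A `<=` B)%fset -> `|s - \sum_(i <- B) a i| <= e.
Proof.
split=> [h e e0|h].
  have /cvgrPdist_le/(_ e e0) [A _ hA] := h.
  by exists A => B /hA; rewrite /= partial_sumE.
apply/cvgrPdist_le => e e0; have [A hA] := h e e0.
by exists A => // B /hA; rewrite partial_sumE.
Qed.

Lemma hasSum_unique I (a : I -> R) s t : hasSum a s -> hasSum a t -> s = t.
Proof. by move=> h1 h2; apply: (cvg_unique _ h1 h2); exact: Rhausdorff. Qed.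

Lemma hasSumD I (a b : I -> R) s t :
  hasSum a s -> hasSum b t -> hasSum (fun i => a i + b i) (s + t).
Proof.
move=> ha hb; rewrite /hasSum.
have -> : partial_sum (fun i => a i + b i) = (partial_sum a \+ partial_sum b).
  by apply/funext => A; rewrite /= !partial_sumE big_split.
exact: cvgD.
Qed.

Lemma hasSumZ I (a : I -> R) s k :
  hasSum a s -> hasSum (fun i => k * a i) (k * s).
Proof.
move=> ha; rewrite /hasSum.
have -> : partial_sum (fun i => k * a i) = (fun A => k * partial_sum a A).
  by apply/funext => A; rewrite /= !partial_sumE mulr_sumr.
by apply: cvgM => //; exact: cvg_cst.
Qed.

Lemma hasSum_single I (i0 : I) (a : I -> R) :
  (forall i, i != i0 -> a i = 0) -> hasSum a (a i0).
Proof.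
move=> h; apply/hasSumP => e e0; exists [fset i0]%fset => B.
rewrite fsub1set => iB; rewrite (big_fsetD1 i0) //= big_seq big1.
  by rewrite addr0 subrr normr0 ltW.
by move=> i; rewrite in_fsetD1 => /andP[/h].
Qed.

Lemma hasSum_sum I K (s : seq K) (a : K -> I -> R) (p : K -> R) :
  (forall k, hasSum (a k) (p k)) ->
  hasSum (fun i => \sum_(k <- s) a k i) (\sum_(k <- s) p k).
Proof.
move=> h; elim: s => [|k s IH].
  rewrite big_nil; apply/hasSumP => e e0; exists fset0 => B _.
  by rewrite big1 ?subrr ?normr0 ?ltW // => i _; rewrite big_nil.
rewrite big_cons; under eq_fun do rewrite big_cons.
exact: hasSumD.
Qed.

Lemma absBound_ge0 I (a : I -> R) M : absBound a M -> 0 <= M.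
Proof. by move=> /(_ fset0); rewrite big_seq_fset0. Qed.

Lemma absBound_le I (a b : I -> R) M :
  (forall i, `|a i| <= `|b i|) -> absBound b M -> absBound a M.
Proof. by move=> h hb A; apply: le_trans (hb A); apply: ler_sum. Qed.

Lemma hasSum_le I (a : I -> R) s M :
  hasSum a s -> absBound a M -> `|s| <= M.
Proof.
move=> /hasSumP h hM; apply/ler_addgt0Pr => e e0.
have [A /(_ A (fsubset_refl _)) hA] := h e e0.
have -> : s = (s - \sum_(i <- A) a i) + \sum_(i <- A) a i by rewrite subrK.
apply: le_trans (ler_normD _ _) _; rewrite addrC lerD //.
by apply: le_trans (hM A); exact: ler_norm_sum.
Qed.

Lemma sum_fset_sub I (a : I -> R) (A B : {fset I}) : (A `<=` B)%fset ->
  \sum_(i <- B) a i = \sum_(i <- A) a i + \sum_(i <- B | i \notin A) a i.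
Proof.
move=> sAB; rewrite (big_fsetID _ (mem A) B) [X in _ = _ + X]big_fset_condE.
rewrite (_ : [fset x in B | x \in A]%fset = A) //.
by apply/fsetP => i; rewrite !inE andb_idl// => /(fsubsetP sAB).
Qed.

Lemma ler_sum_fset I (a : I -> R) (A B : {fset I}) :
  (forall i, 0 <= a i) -> (A `<=` B)%fset ->
  \sum_(i <- A) a i <= \sum_(i <- B) a i.
Proof.
by move=> a0 /sum_fset_sub ->; rewrite lerDl sumr_ge0.
Qed.

Lemma hasSum_nonneg I (a : I -> R) M :
  (forall i, 0 <= a i) -> (forall A : {fset I}, \sum_(i <- A) a i <= M) ->
  exists s, hasSum a s.
Proof.
move=> a0 hM; pose E := [set \sum_(i <- A) a i | A in [set: {fset I}]].
have hE : has_sup E.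
  split; first by exists (\sum_(i <- (fset0 : {fset I})) a i), fset0.
  by exists M => _ [A _ <-]; exact: hM.
exists (sup E); apply/hasSumP => e e0.
have [_ [A _ <-] hA] := sup_adherent e0 hE.
exists A => B AB; have hB : \sum_(i <- B) a i <= sup E.
  by apply: ub_le_sup; [case: hE|exists B].
rewrite ger0_norm ?subr_ge0 //; have := ler_sum_fset a0 AB; lra.
Qed.

(** [a] is the difference of the nonnegative families [|a| + a] and [|a|]. *)
Lemma absBound_hasSum I (a : I -> R) M : absBound a M -> exists s, hasSum a s.
Proof.
move=> h; have [s hs] := @hasSum_nonneg _ (fun i => `|a i|) M (fun i => normr_ge0 _) h.
have [t ht] : exists t, hasSum (fun i => `|a i| + a i) t.
  apply: (@hasSum_nonneg _ _ (M + M)) => [i|A]; first by have := ler_norm (- a i);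
      rewrite normrN; lra.
  rewrite big_split lerD //; apply: le_trans (h A).
  by apply: ler_sum => i _; exact: ler_norm.
exists (t + -1 * s); have := hasSumD ht (@hasSumZ _ _ _ (-1) hs).
by congr hasSum; apply/funext => i; ring.
Qed.

(** By the Cauchy criterion at 1, finite sums off some finite [A] are at most 2 in absolute value.
    Outside [A], the terms of each sign thus contribute at most 2 to the sum of absolute values,
    whence the 4. *)
Lemma hasSum_absBound I (a : I -> R) s :
  hasSum a s -> exists M, absBound a M.
Proof.
move=> /hasSumP/(_ 1 ltr01) [A hA].
have disj B : [disjoint A & B]%fset -> `|\sum_(i <- B) a i| <= 2.
  move=> dAB; have := hA (A `|` B)%fset (fsubsetUl _ _).
  have := hA A (fsubset_refl _); rewrite (sum_fset_sub a (fsubsetUl A B)).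
  have -> : \sum_(i <- (A `|` B)%fset | i \notin A) a i = \sum_(i <- B) a i.
    rewrite big_fset_condE (_ : [fset x in (A `|` B)%fset | x \notin A]%fset = B) //.
    apply/fsetP => i; rewrite !inE; case: (boolP (i \in A)) => //= iA; rewrite ?andbT //.
    by rewrite (negbTE (fdisjointP dAB _ iA)).
  set x := \sum_(i <- A) a i; set y := \sum_(i <- B) a i.
  by rewrite !ler_norml => /andP[? ?] /andP[? ?]; apply/andP; split; lra.
exists (\sum_(i <- A) `|a i| + 4) => B.
rewrite (big_fsetID _ (mem A) B) /=.
apply: lerD.
  apply: ler_sum_fset => //; apply/fsubsetP => i.
  by rewrite !inE => /andP[].
rewrite (big_fsetID _ (fun i => 0 <= a i)) /=.
have -> : 4 = 2 + 2 :> R by ring.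
apply: lerD.
  rewrite (_ : \sum_(i <- _) _ = \sum_(i <- [fset x | x in [fset x | x in B & x \notin
      A] & (0 <= a x)%R]%fset) a i).
    apply: le_trans (ler_norm _) (disj _ _).
    by apply/fdisjointP => i iA; rewrite !inE iA andbF.
  by rewrite !big_seq; apply: eq_bigr => i; rewrite !inE => /andP[_ h]; rewrite ger0_norm.
rewrite (_ : \sum_(i <- _) _ = - \sum_(i <- [fset x | x in [fset x | x in B & x \notin
    A] & ~~ (0 <= a x)%R]%fset) a i).
  apply: le_trans (ler_norm _) _; rewrite normrN; apply: disj.
  by apply/fdisjointP => i iA; rewrite !inE iA andbF.
rewrite -sumrN !big_seq; apply: eq_bigr => i; rewrite !inE => /andP[_].
by rewrite -ltNge => /ltW h; rewrite ler0_norm.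
Qed.

Section Reindex.
Variables (I K : choiceType) (h : I -> K) (g : K -> I) (hK : cancel h g).
Variables (a : I -> R) (b : K -> R).
Hypotheses (bh : forall i, b (h i) = a i) (b0 : forall k, h (g k) != k -> b k = 0).

Let pre (B : {fset K}) : {fset I} := [fset g k | k in [fset k in B | h (g k) == k]]%fset.

(** The hypotheses make [b] the extension by zero of [a] along the injection [h]; the test
    [h (g k) == k] decides whether [k] is in the image. *)
Lemma sum_reindex (phi : R -> R) (B : {fset K}) : phi 0 = 0 ->
  \sum_(k <- B) phi (b k) = \sum_(i <- pre B) phi (a i).
Proof.
move=> phi0; rewrite big_imfset /=; last first.
  move=> x y; rewrite !inE => /andP[_ /eqP {2}<-] /andP[_ /eqP {2}<-].
  by move=> ->.
rewrite (big_fsetID _ (fun k => h (g k) == k)) /=.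
rewrite -[RHS]addr0; congr (_ + _); rewrite big_seq.
  rewrite [RHS]big_seq; apply: eq_bigr => k; rewrite !inE => /andP[_ /eqP hk].
  by rewrite -bh hk.
by rewrite big1 // => k; rewrite !inE => /andP[_ /b0 ->].
Qed.

Lemma hasSum_reindex s : hasSum a s -> hasSum b s.
Proof.
move=> /hasSumP ha; apply/hasSumP => e /ha [A hA].
exists [fset h i | i in A]%fset => B AB.
rewrite (sum_reindex (phi := id)) //; apply: hA; apply/fsubsetP => i iA.
apply/imfsetP; exists (h i); rewrite ?hK// !inE hK eqxx andbT.
by apply: (fsubsetP AB); apply/imfsetP; exists i.
Qed.

Lemma absBound_reindex M : absBound a M -> absBound b M.
Proof. by move=> ha B; rewrite (sum_reindex (phi := fun x => `|x|)) ?normr0. Qed.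
End Reindex.

(** Outside a finite set [A0] of rows the bounds [M] have a small sum. On the rows of [A0], a large
    enough finite set of columns leaves small remainders [d B i]; elsewhere a remainder is at most
    [2 * M i]. *)
Lemma hasSum_fubini I K (a : I -> K -> R) (M p : I -> R) (q : K -> R) C P :
  (forall i, absBound (a i) (M i)) -> absBound M C ->
  (forall i, hasSum (a i) (p i)) -> hasSum p P ->
  (forall k, hasSum (a^~ k) (q k)) -> hasSum q P.
Proof.
move=> haM hMC hap hpP haq.
have M0 i : 0 <= M i by apply: absBound_ge0 (haM i).
have [m hm] := absBound_hasSum hMC.
(* The 6 is 1 for replacing the sum of the remainders by a finite one, 1 for the rows of [A0], and 2
   * 2 for the other rows. *)
suff H e : 0 < e -> exists A : {fset K},
    forall B : {fset K}, (A `<=` B)%fset -> `|P - \sum_(i <- B) q i| <= 6 * e.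
  apply/hasSumP => e e0; have [|A hA] := H (e / 6); first lra.
  by exists A => B /hA; rewrite mulrCA divff// mulr1.
move=> e0; have /hasSumP/(_ e e0) [A0 hA0] := hm.
have tail A : (A0 `<=` A)%fset -> \sum_(i <- A | i \notin A0) M i <= 2 * e.
  move=> sA; have := hA0 _ sA; have := hA0 _ (fsubset_refl _).
  rewrite (sum_fset_sub M sA) => /=.
  set x := \sum_(i <- A0) M i; set y := \sum_(i <- A | _) M i.
  by rewrite !ler_norml => /andP[? ?] /andP[? ?]; lra.
pose d (B : {fset K}) i := p i - \sum_(k <- B) a i k.
have dM B i : `|d B i| <= 2 * M i.
  rewrite mulr2n mulrDl mul1r; apply: le_trans (ler_normB _ _) _; apply: lerD.
    exact: hasSum_le (hap i) (haM i).
  by apply: le_trans (haM i B); exact: ler_norm_sum.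
have [B0 hB0] : exists B0 : {fset K}, forall B : {fset K}, (B0 `<=` B)%fset ->
    \sum_(i <- A0) `|d B i| <= e.
  elim: {hA0 tail}(A0 : seq I) (e) e0 => [|i s IH] e' e'0.
    by exists fset0 => B _; rewrite big_nil ltW.
  have e2 : 0 < e' / 2 by lra.
  have [B1 h1] := IH _ e2; have /hasSumP/(_ _ e2) [B2 h2] := hap i.
  exists (B1 `|` B2)%fset => B; rewrite fsubUset => /andP[/h1 ? /h2 ?].
  by rewrite big_cons /d; lra.
exists B0 => B sB.
have dsum : hasSum (d B) (P - \sum_(k <- B) q k).
  have := hasSumD hpP (@hasSumZ _ _ _ (-1) (hasSum_sum (s := B) haq)).
  by congr hasSum; [apply/funext => i; rewrite /d; ring|ring].
have /hasSumP/(_ e e0) [A1 hA1] := dsum.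
have := hA1 (A0 `|` A1)%fset (fsubsetUr _ _).
set x := P - _ => hx.
have : `|\sum_(i <- (A0 `|` A1)%fset) d B i| <= e + 2 * (2 * e); last first.
  move: hx; set y := \sum_(i <- _) d B i.
  by rewrite !ler_norml => /andP[? ?] /andP[? ?]; apply/andP; split; lra.
apply: le_trans (ler_norm_sum _ _ _) _.
rewrite (sum_fset_sub _ (fsubsetUl A0 A1)); apply: lerD; first exact: hB0.
apply: le_trans (ler_sum _ (fun i _ => dM B i)) _.
rewrite -mulr_sumr ler_pM2l //.
exact: tail (fsubsetUl _ A1).
Qed.

End UnconditionalSums.

(** * Composition of analytic functions *)

Section AnalyticComposition.
Variable R : realType.

(** * Power series with a bounded weighted norm on a cube *)

Section Represented.
Variable n : nat.
Implicit Types (r t M N : R) (x : 'rV[R]_n) (al be : {ffun 'I_n -> nat}).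

Definition incube r x : Prop := forall i, `|x 0 i| <= r.

(* The weighted l^1 norm bounded by M is submultiplicative, which is what makes
   the substitution of one power series into another converge. *)
Definition rep r M (f : 'rV[R]_n -> R) : Prop :=
  exists u : {ffun 'I_n -> nat} -> R,
    absBound (fun al => u al * monomial (const_mx r) al) M /\
    forall x, incube r x -> hasSum (fun al => u al * monomial x al) (f x).

Lemma monomial_le r x al : incube r x ->
  `|monomial x al| <= `|monomial (const_mx r) al|.
Proof.
move=> hx; rewrite /monomial !normr_prod; apply: ler_prod => i _.
rewrite normr_ge0 !normrX mxE lerXn2r ?nnegrE ?normr_ge0 //.
exact: le_trans (hx i) (ler_norm _).
Qed.

Lemma rep_bound r M f x : rep r M f -> incube r x -> `|f x| <= M.
Proof.
move=> [u [hu hf]] hx; apply: hasSum_le (hf _ hx) _.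
apply: absBound_le hu => al; rewrite !normrM ler_wpM2l //; exact: monomial_le.
Qed.

Lemma rep_ge0 r M f : rep r M f -> 0 <= M.
Proof. by move=> [u [/absBound_ge0]]. Qed.

Lemma incube_const r : 0 <= r -> incube r (const_mx r).
Proof. by move=> r0 i; rewrite mxE ger0_norm. Qed.

Lemma incube_le r r' x : r <= r' -> incube r x -> incube r' x.
Proof. by move=> rr' h i; apply: le_trans (h i) rr'. Qed.

Lemma rep_mono r r' M M' f : 0 <= r -> r <= r' -> M' <= M ->
  rep r' M' f -> rep r M f.
Proof.
move=> r0 rr' MM' [u [hu hf]]; exists u; split=> [A|x /(incube_le rr')/hf//].
apply: le_trans MM'; move: A; apply: absBound_le hu => al.
rewrite !normrM ler_wpM2l //; apply: monomial_le.
exact: incube_le rr' (incube_const r0).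
Qed.

Lemma rep_ext r M f g : (forall x, incube r x -> f x = g x) ->
  rep r M f -> rep r M g.
Proof.
by move=> fg [u [hu hf]]; exists u; split=> // x hx; rewrite -fg//; exact: hf.
Qed.

Lemma rep_single r be k : 0 <= r ->
  rep r (`|k| * monomial (const_mx r) be) (fun x => k * monomial x be).
Proof.
move=> r0; have r'0 al : 0 <= monomial (const_mx r : 'rV_n) al.
  by apply: prodr_ge0 => i _; rewrite mxE exprn_ge0.
exists (fun al => if al == be then k else 0); split=> [A|x _].
  have [beA|beA] := boolP (be \in A); last first.
    rewrite big_seq big1 ?mulr_ge0 // => al alA; case: eqP => [E|_].
      by rewrite -E alA in beA.
    by rewrite mul0r normr0.
  rewrite (big_fsetD1 be) //= eqxx big_seq big1.
    by rewrite addr0 normrM (ger0_norm (r'0 _)).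
  by move=> al; rewrite in_fsetD1 => /andP[/negbTE -> _]; rewrite mul0r normr0.
have := @hasSum_single R _ be (fun al => (if al == be then k else 0) * monomial x al).
by rewrite eqxx; apply => al /negbTE ->; rewrite mul0r.
Qed.

Lemma rep_cst r k : 0 <= r -> rep r `|k| (fun=> k).
Proof.
move=> r0; have := @rep_single r [ffun=> 0%N] k r0.
have E x : monomial x [ffun=> 0%N] = 1.
  by rewrite /monomial big1 // => i _; rewrite ffunE expr0.
by rewrite E mulr1; apply: rep_ext => x _; rewrite E mulr1.
Qed.

Lemma rep_coord r i : 0 <= r -> rep r r (fun x => x 0 i).
Proof.
move=> r0; have := @rep_single r [ffun j => nat_of_bool (j == i)] 1 r0.
have E x : monomial x [ffun j => nat_of_bool (j == i)] = x 0 i.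
  rewrite /monomial (bigD1 i) //= ffunE eqxx expr1 big1 ?mulr1 // => j /negbTE h.
  by rewrite ffunE h expr0.
rewrite E mxE normr1 mul1r; apply: rep_ext => x _; by rewrite E mul1r.
Qed.

Lemma rep_add r M N f g : rep r M f -> rep r N g ->
  rep r (M + N) (fun x => f x + g x).
Proof.
move=> [u [hu hf]] [v [hv hg]]; exists (fun al => u al + v al); split=> [A|x hx].
  apply: le_trans (lerD (hu A) (hv A)); rewrite -big_split.
  by apply: ler_sum => al _; rewrite mulrDl ler_normD.
under eq_fun do rewrite mulrDl.
by apply: hasSumD; [exact: hf|exact: hg].
Qed.

Lemma monomialD x al be :
  monomial x [ffun i => (al i + be i)%N] = monomial x al * monomial x be.
Proof.
by rewrite /monomial -big_split; apply: eq_bigr => i _; rewrite ffunE exprD.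
Qed.

Lemma rep_shift r M k be g : 0 <= r -> rep r M g ->
  rep r (`|k * monomial (const_mx r) be| * M) (fun x => k * monomial x be * g x).
Proof.
move=> r0 [u [hu hg]].
(* Subtraction being truncated, [h (s al) == al] tests whether [be <= al] componentwise. *)
pose h al := [ffun i => (be i + al i)%N]; pose s al := [ffun i => (al i - be i)%N].
have hK : cancel h s by move=> al; apply/ffunP => i; rewrite !ffunE addKn.
pose v al := if h (s al) == al then k * u (s al) else 0.
have vh x al : v (h al) * monomial x (h al) = k * monomial x be * (u al * monomial x al).
  by rewrite /v hK eqxx monomialD; ring.
have v0 x al : h (s al) != al -> v al * monomial x al = 0.
  by rewrite /v => /negbTE ->; rewrite mul0r.
exists v; split=> [|x hx].
  apply: (absBound_reindex (vh (const_mx r)) (v0 (const_mx r))) => A.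
  under eq_bigr do rewrite normrM.
  by rewrite -mulr_sumr ler_wpM2l.
apply: (hasSum_reindex hK (vh x) (v0 x)); apply: hasSumZ; exact: hg.
Qed.

(** Completeness of the weighted l^1 space: the coefficients of the sum are the sums of the
    coefficients, and Fubini exchanges the two summations. *)
Lemma rep_series (I : choiceType) r C (M : I -> R) (p : I -> 'rV[R]_n -> R) f :
  0 < r -> (forall i, rep r (M i) (p i)) -> absBound M C ->
  (forall x, incube r x -> hasSum (p^~ x) (f x)) -> rep r C f.
Proof.
move=> r0 hp hM hf; have r0' := ltW r0.
have [u hu] := choice hp.
have w0 al : 0 < monomial (const_mx r : 'rV_n) al.
  by apply: prodr_gt0 => i _; rewrite mxE exprn_gt0.
have M0 i := rep_ge0 (hp i).
have uM i al : `|u i al * monomial (const_mx r) al| <= M i.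
  by have := (hu i).1 [fset al]%fset; rewrite big_seq_fset1.
(* Each weighted coefficient of [p i] is at most [M i], so the coefficients at [al] form a summable
   family over [I]. *)
have exq al : exists q, hasSum (u^~ al) q.
  apply: (@absBound_hasSum _ _ _ (C / monomial (const_mx r) al)) => A.
  rewrite ler_pdivlMr // mulr_suml; apply: le_trans (hM A).
  apply: ler_sum => i _; apply: le_trans (ler_norm _).
  by apply: le_trans (uM i al); rewrite normrM (gtr0_norm (w0 _)).
have [q hq] := choice exq.
exists q; split=> [A|x hx]; last first.
  apply: (hasSum_fubini (a := fun i al => u i al * monomial x al)
           (M := M) (C := C) (p := p^~ x)) => //.
  - move=> i; apply: absBound_le (hu i).1 => al.
    rewrite !normrM ler_wpM2l //; exact: monomial_le.
  - by move=> i; apply: (hu i).2.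
  - exact: hf.
  - move=> al; rewrite mulrC; under eq_fun do rewrite mulrC.
    exact: hasSumZ.
(* signs make the finite sum of the |q al| a limit of sums over I *)
pose sg al := Num.sg (q al) * monomial (const_mx r) al.
have hs : hasSum (fun i => \sum_(al <- A) sg al * u i al) (\sum_(al <- A) sg al * q al).
  apply: hasSum_sum => al; exact: hasSumZ.
have E : \sum_(al <- A) `|q al * monomial (const_mx r) al| = \sum_(al <- A) sg al * q al.
  apply: eq_bigr => al _; rewrite normrM (gtr0_norm (w0 _)) /sg.
  by rewrite {1}normrEsg; ring.
rewrite E; apply: le_trans (ler_norm _) _; apply: hasSum_le hs _.
apply: absBound_le hM => i; rewrite (ger0_norm (M0 i)).
apply: le_trans (ler_norm_sum _ _ _) _; apply: le_trans ((hu i).1 A).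
apply: ler_sum => al _;
    rewrite /sg !normrM (mulrC _ `|monomial _ _|) -mulrA [X in _ <= X]mulrC.
rewrite ler_wpM2l // ler_piMl //.
by rewrite normr_sg; case: (_ != 0).
Qed.

(** The product is the series, over the monomials of [f], of shifted copies of [g]. *)
Lemma rep_mul r M N f g : 0 < r -> rep r M f -> rep r N g ->
  rep r (M * N) (fun x => f x * g x).
Proof.
move=> r0 [u [hu hf]] hg; have N0 := rep_ge0 hg.
apply: (rep_series (M := fun be => `|u be * monomial (const_mx r) be| * N)
  (p := fun be x => u be * monomial x be * g x)) => //.
- by move=> be; apply: rep_shift; rewrite ?ltW.
- move=> A; under eq_bigr do rewrite normrM normr_id (ger0_norm N0).
  by rewrite -mulr_suml ler_wpM2r.
- move=> x hx; rewrite mulrC; under eq_fun do rewrite mulrC.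
  by apply: hasSumZ; exact: hf.
Qed.

Lemma rep_exp r M f k : 0 < r -> rep r M f -> rep r (M ^+ k) (fun x => f x ^+ k).
Proof.
move=> r0 hf; elim: k => [|k IH].
  by have := @rep_cst r 1 (ltW r0); rewrite normr1.
rewrite exprS; under eq_fun do rewrite exprS.
exact: rep_mul.
Qed.

Lemma rep_prod (I : Type) (s : seq I) r (M : I -> R) (f : I -> 'rV[R]_n -> R) :
  0 < r -> (forall i, rep r (M i) (f i)) ->
  rep r (\prod_(i <- s) M i) (fun x => \prod_(i <- s) f i x).
Proof.
move=> r0 hf; elim: s => [|i s IH].
  rewrite big_nil; apply: rep_ext (_ : rep r 1 (fun=> 1)) => [x _|].
    by rewrite big_nil.
  by have := @rep_cst r 1 (ltW r0); rewrite normr1.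
rewrite big_cons; apply: rep_ext (rep_mul r0 (hf i) IH) => x _.
by rewrite big_cons.
Qed.

(* The constant term being 0, every monomial gains a factor t. *)
Lemma rep_shrink r t M f : 0 <= r -> 0 < t <= 1 -> f 0 = 0 ->
  rep r M f -> rep (t * r) (t * M) f.
Proof.
move=> r0 /andP[t0 t1] f0 [u [hu hf]]; exists u.
(* At 0 every other monomial vanishes, so the constant coefficient is [f 0]. *)
have u0 : u [ffun=> 0%N] = 0.
  have h0 : incube r (0 : 'rV_n) by move=> i; rewrite mxE normr0.
  have := hf _ h0; rewrite f0 => h.
  have := @hasSum_single R _ [ffun=> 0%N] (fun al => u al * monomial (0 : 'rV_n) al).
  rewrite {3}/monomial big1; last by move=> i _; rewrite ffunE expr0.
  rewrite mulr1 => h'; apply: hasSum_unique (h' _) h => al al0.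
  suff [i hi] : exists i, al i != 0%N.
    by rewrite /monomial (bigD1 i) //= mxE expr0n (negbTE hi) mul0r mulr0.
  apply/existsP; apply: contraNT al0 => /existsPn h0'.
  by apply/eqP/ffunP => i; rewrite ffunE; have := h0' i; rewrite negbK => /eqP.
split=> [A|x hx]; last first.
  by apply: hf; apply: incube_le hx; rewrite ler_piMl.
apply: le_trans (_ : \sum_(al <- A) t * `|u al * monomial (const_mx r) al| <= _).
  apply: ler_sum => al _; have [->|al0] := eqVneq al [ffun=> 0%N].
    by rewrite u0 !mul0r normr0 mulr0.
  rewrite !normrM mulrCA ler_wpM2l //.
  have -> : monomial (const_mx (t * r)) al = t ^+ (\sum_i al i) * monomial (const_mx r
      : 'rV_n) al.
    rewrite -prodrXr -big_split; apply: eq_bigr => i _.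
    by rewrite !mxE exprMn.
  rewrite normrM ler_wpM2r // normrX gtr0_norm //.
  case E: (\sum_i al i)%N => [|k].
    case/eqP: al0; apply/ffunP => i; rewrite ffunE; apply/eqP.
    have /eqP := E; rewrite sum_nat_eq0 => /forallP/(_ i); by rewrite implyTb.
  have t0' := ltW t0; by rewrite exprS ler_piMr // exprn_ile1.
by rewrite -mulr_sumr ler_pM2l.
Qed.

Lemma incube_shift_near (a : 'rV[R]_n) r : 0 < r -> \forall x \near a, incube r (x - a).
Proof.
move=> r0; have h i : \forall x \near a, `|(x - a) 0 i| <= r.
  have /cvgr_dist_le/(_ r r0) := @coord_continuous R 1 n 0 i a.
  by apply: filterS => x; rewrite !mxE distrC.
exact: filter_forall h.
Qed.

(** Unconditional convergence at the single point [const_mx e], a corner of the cube, is absolute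
    and so already bounds the weighted norm. *)
Lemma analytic_atP (a : 'rV[R]_n) f : analytic_at f a <->
  exists r M, 0 < r /\ rep r M (fun x => f (x + a)).
Proof.
split=> [[c hc]|[r [M [r0 [u [_ hu]]]]]]; last first.
  exists u; apply: filterS (incube_shift_near a r0) => x /hu.
  by rewrite subrK.
have [e e0 he] : exists2 e, 0 < e & forall x, incube e x ->
    hasSum (fun al => c al * monomial x al) (f (x + a)).
  have /nbhs_ballP[e /= e0 he] := hc; exists (e / 2); first lra.
  move=> x hx; have := he (x + a); rewrite /= addrK; apply.
  split=> // i j; rewrite ord1 /ball /= mxE opprD addrCA subrr addr0 normrN.
  by apply: le_lt_trans (hx j) _; lra.
have /hasSum_absBound [M hM] := he (const_mx e) (incube_const (ltW e0)).
by exists e, M; split=> //; exists c.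
Qed.

End Represented.

(** After subtracting the constant terms [h a], shrinking the cube by [t] also multiplies the norms
    of the components by [t], so [t = min 1 (rho / M)] brings them below [rho]. A monomial in the
    components then has norm at most its value at [const_mx rho], and the series of [g] can be
    substituted termwise. *)
Lemma analytic_at_comp n m (g : 'rV[R]_m -> R) (h : 'rV[R]_n -> 'rV[R]_m) a :
  analytic_at g (h a) -> analytic_map_at h a -> analytic_at (fun x => g (h x)) a.
Proof.
move=> /analytic_atP [rho [N [rho0 [c [hc hg]]]]] hh; apply/analytic_atP.
have {}hh j : exists rM : R * R, 0 < rM.1 /\ 0 < rM.2 /\ rep rM.1 rM.2 (fun x => h (x +
    a) 0 j - h a 0 j).
  have /analytic_atP [r [M [r0 hr]]] := hh j.
  exists (r, M + `|- h a 0 j| + 1) => /=; split=> //.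
  have := rep_add hr (rep_cst _ (- h a 0 j) (ltW r0)) => hr'.
  have := rep_ge0 hr'; split; first lra.
  by have r0' := ltW r0; apply: rep_mono hr' => //; rewrite lerDl.
have [rM hrM] := choice hh.
pose r := \big[Num.min/1]_j (rM j).1; pose M := 1 + \sum_j (rM j).2.
have r0 : 0 < r by apply/bigmin_gtP; split=> // j _; case: (hrM j).
have M0 : 0 < M by apply: ltr_pwDl => //; apply: sumr_ge0 => j _;
    case: (hrM j) => _ [/ltW].
have hM j : rep r M (fun x => h (x + a) 0 j - h a 0 j).
  have [r1 [M1 h1]] := hrM j; apply: rep_mono h1; first exact: ltW.
    exact: bigmin_le.
  rewrite /M (bigD1 j) //= addrCA lerDl addr_ge0 //.
  by apply: sumr_ge0 => k _; case: (hrM k) => _ [/ltW].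
pose t := Num.min 1 (rho / M).
have t0 : 0 < t by rewrite lt_min ltr01 divr_gt0.
have t1 : t <= 1 by rewrite ge_min lexx.
have tM : t * M <= rho by rewrite -ler_pdivlMr // ge_min lexx orbT.
have hj j : rep (t * r) rho (fun x => h (x + a) 0 j - h a 0 j).
  have : rep (t * r) (t * M) (fun x => h (x + a) 0 j - h a 0 j).
    by apply: rep_shrink (ltW r0) _ _ (hM j); rewrite ?t0 // add0r subrr.
  by apply: rep_mono => //; rewrite mulr_ge0 ?ltW.
have tr0 : 0 < t * r by rewrite mulr_gt0.
exists (t * r), N; split=> //.
apply: (rep_series (M := fun al => `|c al * monomial (const_mx rho) al|)
   (p := fun al x => c al * monomial (h (x + a) - h a) al)) => //.
- move=> al; rewrite normrM; apply: rep_mul => //; first exact/rep_cst/ltW.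
  rewrite ger0_norm; last by apply: prodr_ge0 => i _; rewrite mxE exprn_ge0 ?ltW.
  rewrite /monomial; apply: rep_prod => // j.
  rewrite mxE; apply: rep_exp => //.
  by apply: rep_ext (hj j) => x _; rewrite !mxE.
- by move=> A; under eq_bigr do rewrite normr_id; exact: hc.
- move=> x hx; rewrite -[h (x + a)](subrK (h a)) addrK; apply: hg => j.
  by rewrite !mxE; apply: rep_bound (hj j) hx.
Qed.

Lemma analytic_at_coord n (i : 'I_n) a : @analytic_at R n (fun x => x 0 i) a.
Proof.
apply/analytic_atP; exists 1, (1 + `|a 0 i|); split=> //.
have h := rep_add (rep_coord i (@ler01 R)) (rep_cst _ (a 0 i) (@ler01 R)).
by apply: rep_ext h => x _; rewrite mxE.
Qed.

Lemma analytic_at_affine n (i : 'I_n) (k l : R) a :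
  analytic_at (fun x : 'rV[R]_n => k + l * x 0 i) a.
Proof.
apply/analytic_atP; exists 1, (`|k + l * a 0 i| + `|l| * 1); split=> //.
have h := rep_add (rep_cst _ (k + l * a 0 i) (@ler01 R))
  (rep_mul ltr01 (rep_cst _ l (@ler01 R)) (rep_coord i (@ler01 R))).
by apply: rep_ext h => x _; rewrite mxE; ring.
Qed.

End AnalyticComposition.

(** * Subanalytic open sets *)

Section Topology.

Lemma finite_set_ind (T : eqType) (P : set T -> Prop) : P set0 ->
  (forall x A, finite_set A -> P A -> P (x |` A)) ->
  forall A, finite_set A -> P A.
Proof.
move=> P0 PU A /finite_seqP [s ->]; elim: s => [|x s IH].
  by rewrite (_ : [set` [::]] = set0) // -subset0 => y.
rewrite (_ : [set` x :: s] = x |` [set` s]); first exact: PU.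
by apply/seteqP; split=> y /=; rewrite inE => /predU1P.
Qed.

Lemma finite_powerset (T : eqType) (A : set T) :
  finite_set A -> finite_set [set B | B `<=` A].
Proof.
move: A; apply: finite_set_ind => [|x A fA IH].
  by apply: sub_finite_set (finite_set1 set0) => B; rewrite /= subset0.
have h := finite_image (fun B => x |` B) IH.
apply: sub_finite_set (_ : finite_set ([set B | B `<=` A] `|` _)); last first.
  by rewrite finite_setU; split; [exact: IH|exact: h].
move=> B /= sB; have [xB|xB] := pselect (B x); last first.
  by left=> y By; have [yx|//] := sB y By; rewrite -yx in xB.
right; exists (B `\ x) => [y [By yx]|]; first by have [] := sB y By.
by rewrite setDUK // => y ->.
Qed.

Lemma open_finite_bigcap (T : topologicalType) (I : eqType) (D : set I) (F : I -> set T) :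
  finite_set D -> (forall i, D i -> open (F i)) -> open (\bigcap_(i in D) F i).
Proof.
move=> fD; move: D fD; apply: finite_set_ind => [|x A fA IH] h.
  by rewrite bigcap_set0; exact: openT.
rewrite bigcap_setU1; apply: openI; first by apply: h; left.
by apply: IH => i Ai; apply: h; right.
Qed.

(** Along the filter of finite subfamilies ordered by inclusion, lying in the union of the subfamily
    holds near each point of [K]; compactness makes this uniform. *)
Lemma compact_finite_subcover (T : topologicalType) (K : set T) (F : set (set T)) :
  compact K -> F `<=` open -> K `<=` \bigcup_(A in F) A ->
  exists D, [/\ finite_set D, D `<=` F & K `<=` \bigcup_(A in D) A].
Proof.
move=> /compact_near_coveringP cK Fo KF.
pose Fin := [set D | finite_set D /\ D `<=` F].
pose G : set_system (set (set T)) :=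
  filter_from Fin (fun D => [set E | Fin E /\ D `<=` E]).
have Gfilter : ProperFilter G.
  apply: filter_from_proper; last first.
    by move=> D FD; exists D; split.
  apply: filter_from_filter; first by exists set0; split.
  move=> D E [fD sD] [fE sE]; exists (D `|` E).
    by split; [rewrite finite_setU|move=> A [/sD|/sE]].
  by move=> H [FH sH]; split; split=> // A hA; apply: sH; [left|right].
have [|D [fD sD] hD] := cK _ G (fun D y => (\bigcup_(A in D) A) y) _.
  move=> x /KF [A FA Ax]; exists (A, [set E | Fin E /\ [set A] `<=` E]) => /=.
    split; first by apply: open_nbhs_nbhs; split=> //; exact: Fo.
    by exists [set A] => //; split=> [//|B ->].
  by move=> [y E] [/= Ay [_ sE]]; exists A => //; exact: sE.
exists D; split=> //; by apply: hD; split.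
Qed.

Lemma hausdorff_prod (T U : topologicalType) :
  hausdorff_space T -> hausdorff_space U -> hausdorff_space (T * U)%type.
Proof.
move=> hT hU [x y] [x' y'] hc; congr (_, _).
  apply: hT => A B nA nB.
  have [||[a b] [/= Aa Ba]] := hc (A `*` setT) (B `*` setT).
  - by exists (A, setT) => //; split=> //; exact: filterT.
  - by exists (B, setT) => //; split=> //; exact: filterT.
  - by exists a; case: Aa; case: Ba.
apply: hU => A B nA nB.
have [||[a b] [/= Aa Ba]] := hc (setT `*` A) (setT `*` B).
- by exists (setT, A) => //; split=> //; exact: filterT.
- by exists (setT, B) => //; split=> //; exact: filterT.
- by exists b; case: Aa; case: Ba.
Qed.

Lemma closure_sub_compact (T : topologicalType) (A K : set T) :
  hausdorff_space T -> compact K -> A `<=` K -> closure A `<=` K.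
Proof.
move=> hT cK AK x clx; apply: (compact_closed hT cK).
exact: closure_subset AK _ clx.
Qed.

Lemma compact_closure_sub (T : topologicalType) (A K : set T) :
  hausdorff_space T -> compact K -> A `<=` K -> compact (closure A).
Proof.
move=> hT cK AK; apply: (subclosed_compact (@closed_closure _ A) cK).
exact: closure_sub_compact hT cK AK.
Qed.

Lemma nbhs_map_snd (T U U' : topologicalType) (g : U -> U') (p : T * U) (V : set (T *
    U')) :
  {for p.2, continuous g} -> nbhs (p.1, g p.2) V ->
  nbhs p [set q | V (q.1, g q.2)].
Proof.
move=> cg [[A B] /= [nA nB] sV]; exists (A, g @^-1` B) => /=.
  by split=> //; exact: cg.
by move=> [a b] [/= Aa Bb]; exact: sV.
Qed.

Lemma nbhs_fst (T U : topologicalType) (p : T * U) (V : set T) :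
  nbhs p.1 V -> nbhs p [set q | V q.1].
Proof.
by move=> nV; exists (V, setT); [split=> //; exact: filterT|case=> a b []].
Qed.

End Topology.

(** * Intersections of subanalytic sets, and coordinate cubes *)

Section SubanalyticSets.
Variables (R : realType) (X : analyticManifold R).

(** Arbitrary finite index types allow pairs and disjoint sums of indices without renumbering. *)
Lemma semianalytic_fin (m : nat) (B : set (X * 'rV[R]_m)) :
  (forall p : X * 'rV[R]_m, exists (c : chart R X) (V : set (X * 'rV[R]_m)) (I J :
      finType)
         (f : I -> J -> 'rV[R]_(chart_dim c + m) -> R) (strict : I -> J -> bool),
    [/\ atlas c,
        nbhs p V,
        (forall q, V q -> chart_dom c q.1),
        (forall q i j, V q -> analytic_at (f i j) (prod_coord c q)) &
        forall q, V q ->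
          (B q <-> exists i, forall j,
             if strict i j then 0 < f i j (prod_coord c q)
             else f i j (prod_coord c q) == 0)]) ->
  semianalytic B.
Proof.
move=> h p; have [c [V [I [J [f [st [hc nV hd ha hB]]]]]]] := h p.
exists c, V, #|I|, #|J|, (fun i j => f (enum_val i) (enum_val j)),
  (fun i j => st (enum_val i) (enum_val j)); split=> // [q i j|q Vq]; first exact: ha.
rewrite hB //; split=> [[i hi]|[i hi]].
  by exists (enum_rank i) => j; rewrite enum_rankK; exact: hi.
by exists (enum_val i) => j; have := hi (enum_rank j); rewrite enum_rankK.
Qed.

Lemma eq_analytic_at n (f g : 'rV[R]_n -> R) a :
  f =1 g -> analytic_at f a -> analytic_at g a.
Proof. by move=> /funext ->. Qed.

Lemma analytic_map_coord n m (s : 'I_m -> 'I_n) (h : 'rV[R]_n -> 'rV[R]_m) a :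
  (forall w j, h w 0 j = w 0 (s j)) -> analytic_map_at h a.
Proof.
move=> hs j; apply: eq_analytic_at (analytic_at_coord (s j) a) => w.
by rewrite hs.
Qed.

Lemma row_mx_lr n1 n2 (P : 'I_(n1 + n2) -> Prop) :
  (forall j, P (lshift n2 j)) -> (forall j, P (rshift n1 j)) -> forall j, P j.
Proof.
move=> hl hr j; case: (split_ordP j) => k ->; [exact: hl|exact: hr].
Qed.

(** By distributivity, the conjunction of two unions of intersections is indexed by pairs of
    disjuncts and by the disjoint sum of the two sets of conditions. The conditions on [B'] are
    stated in another chart [c']; [tr'] rewrites them in [c] through the transition map. *)
Lemma semianalytic_fiber_product (m m' : nat) (B : set (X * 'rV[R]_m))
    (B' : set (X * 'rV[R]_m')) :
  semianalytic B -> semianalytic B' ->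
  semianalytic [set q : X * 'rV[R]_(m + m') |
    B (q.1, lsubmx q.2) /\ B' (q.1, rsubmx q.2)].
Proof.
move=> hB hB'; apply: semianalytic_fin => p.
have [c [V [k [l [f [st [hc nV hd ha hBV]]]]]]] := hB (p.1, lsubmx p.2).
have [c' [V' [k' [l' [f' [st' [hc' nV' hd' ha' hBV']]]]]]] := hB' (p.1, rsubmx p.2).
pose tr w : 'rV[R]_(chart_dim c + m) := row_mx (lsubmx w) (lsubmx (rsubmx w : 'rV[R]_(m
    + m'))).
pose tr' w : 'rV[R]_(chart_dim c' + m') :=
  row_mx ((chart_map c' \o chart_inv c) (lsubmx w)) (rsubmx (rsubmx w : 'rV[R]_(m + m'))).
pose F (ii : 'I_k * 'I_k') (jj : 'I_l + 'I_l') (w : 'rV[R]_(chart_dim c + (m + m'))) :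
    R :=
  match jj with inl j => f ii.1 j (tr w) | inr j => f' ii.2 j (tr' w) end.
pose ST (ii : 'I_k * 'I_k') (jj : 'I_l + 'I_l') :=
  match jj with inl j => st ii.1 j | inr j => st' ii.2 j end.
have trE q : tr (prod_coord c q) = prod_coord c (q.1, lsubmx q.2).
  by rewrite /tr /prod_coord row_mxKl row_mxKr.
have trE' q : chart_dom c q.1 -> tr' (prod_coord c q) = prod_coord c' (q.1, rsubmx q.2).
  by move=> dq; rewrite /tr' /prod_coord row_mxKl row_mxKr /= chart_mapK.
exists c, [set q | V (q.1, lsubmx q.2) /\ V' (q.1, rsubmx q.2)],
  ('I_k * 'I_k')%type, ('I_l + 'I_l')%type, F, ST; split=> //.
- apply: filterI.
    by apply: (nbhs_map_snd (g := lsubmx)) nV; exact: continuous_lsubmx.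
  by apply: (nbhs_map_snd (g := rsubmx)) nV'; exact: continuous_rsubmx.
- by move=> q [/hd].
- move=> q [i i'] [j|j] [Vq V'q] /=.
    apply: analytic_at_comp; first by rewrite trE; exact: ha.
    apply: row_mx_lr => j'.
      apply: eq_analytic_at (analytic_at_coord (lshift _ j') _) => w.
      by rewrite row_mxEl mxE.
    apply: eq_analytic_at (analytic_at_coord (rshift _ (lshift _ j')) _) => w.
    by rewrite row_mxEr !mxE.
  have dq := hd _ Vq; have d'q := hd' _ V'q.
  apply: analytic_at_comp; first by rewrite trE' //; exact: ha'.
  apply: row_mx_lr => j'; last first.
    apply: eq_analytic_at (analytic_at_coord (rshift _ (rshift _ j')) _) => w.
    by rewrite row_mxEr !mxE.
  apply: (@eq_analytic_at _ (fun w => (chart_map c' \o chart_inv c) (lsubmx w) 0 j')).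
    by move=> w; rewrite row_mxEl.
  apply: (@analytic_at_comp _ _ _ (fun u => (chart_map c' \o chart_inv c) u 0 j')).
    by rewrite /prod_coord row_mxKl; exact: atlas_compat.
  by apply: (@analytic_map_coord _ _ (lshift _)) => w j0; rewrite mxE.
- move=> q [Vq V'q] /=; have dq := hd _ Vq.
  rewrite hBV // hBV' //; split=> [[[i hi] [i' hi']]|[[i i'] h]].
    exists (i, i') => -[j|j] /=; first by rewrite trE; exact: hi.
    by rewrite trE'//; exact: hi'.
  split; [exists i => j; have := h (inl j)|exists i' => j; have := h (inr j)].
    by rewrite /= trE.
  by rewrite /= trE'.
Qed.

Lemma continuous_row_mx m m' :
  continuous (fun p : 'rV[R]_m * 'rV[R]_m' => row_mx p.1 p.2).
Proof.
move=> p A /= [P hP sP].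
pose Q := [set u : 'rV[R]_m | forall i j, P i (lshift _ j) (u i j)].
pose Q' := [set u : 'rV[R]_m' | forall i j, P i (rshift _ j) (u i j)].
exists (Q, Q') => /=.
  split; [exists (fun i j => P i (lshift _ j))|exists (fun i j => P i (rshift _ j))] =>
      // i j.
    by have := hP i (lshift _ j); rewrite row_mxEl.
  by have := hP i (rshift _ j); rewrite row_mxEr.
move=> [u u'] [/= Qu Qu']; apply: sP => /= i; apply: row_mx_lr => j.
  by rewrite row_mxEl; exact: Qu.
by rewrite row_mxEr; exact: Qu'.
Qed.

Lemma rV_hausdorff m : hausdorff_space 'rV[R]_m.
Proof. exact: norm_hausdorff. Qed.

(** The fibre product over X projects onto the intersection, and it stays in the compact set [K]
    built from the projections of the two closures. *)
Lemma subanalyticI (A A' : set X) :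
  subanalytic A -> subanalytic A' -> subanalytic (A `&` A').
Proof.
move=> hA hA' x; have [V [m [B [nV sB cB AV]]]] := hA x.
have [V' [m' [B' [nV' sB' cB' AV']]]] := hA' x.
exists (V `&` V'), (m + m')%N, [set q | B (q.1, lsubmx q.2) /\ B' (q.1, rsubmx q.2)].
split.
- exact: filterI.
- exact: semianalytic_fiber_product.
- pose K := (fst @` closure B) `*` ((fun p => row_mx p.1 p.2) @`
     ((snd @` closure B) `*` (snd @` closure B'))).
  have cf (T U : topologicalType) (C : set (T * U)) : compact C -> compact (fst @` C).
    by apply: continuous_compact; apply: continuous_subspaceT => ?; exact: cvg_fst.
  have cs (T U : topologicalType) (C : set (T * U)) : compact C -> compact (snd @` C).
    by apply: continuous_compact; apply: continuous_subspaceT => ?; exact: cvg_snd.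
  apply: (@compact_closure_sub _ _ K).
  + by apply: hausdorff_prod; [exact: mfd_hausdorff|exact: rV_hausdorff].
  + apply: compact_setX; first exact: cf.
    apply: continuous_compact; last by apply: compact_setX; exact: cs.
    by apply: continuous_subspaceT; exact: continuous_row_mx.
  + move=> [y w] /= [By B'y]; split=> /=.
      by exists (y, lsubmx w) => //; exact: subset_closure.
    exists (lsubmx w, rsubmx w); last by rewrite hsubmxK.
    split=> /=; [exists (y, lsubmx w) => //|exists (y, rsubmx w) => //];
      exact: subset_closure.
- apply/seteqP; split=> [y [[Ay A'y] [Vy V'y]]|_ [[y w] /= [By B'y] <-]].
    have [[y1 u] By /= y1y] : (fst @` B) y by rewrite -AV.
    have [[y2 u'] B'y /= y2y] : (fst @` B') y by rewrite -AV'.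
    rewrite y1y in By; rewrite y2y in B'y.
    by exists (y, row_mx u u') => //=; rewrite row_mxKl row_mxKr.
  have [Ay Vy] : (A `&` V) y by rewrite AV; exists (y, lsubmx w).
  have [A'y V'y] : (A' `&` V') y by rewrite AV'; exists (y, rsubmx w).
  by [].
Qed.

Lemma op_saI (A A' : set X) : op_sa A -> op_sa A' -> op_sa (A `&` A').
Proof. by move=> [oA sA] [oA' sA']; split; [exact: openI|exact: subanalyticI]. Qed.

(* With m = 0, the space X * R^0 is a copy of X. *)
Lemma semianalytic_subanalytic (A K : set X) : compact K -> A `<=` K ->
  semianalytic [set q : X * 'rV[R]_0 | A q.1] -> subanalytic A.
Proof.
move=> cK AK sA x; exists setT, 0%N, [set q | A q.1]; split=> //.
- exact: filterT.
- pose K' : set (X * 'rV[R]_0) := K `*` [set 0].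
  apply: (@compact_closure_sub _ _ K').
  + by apply: hausdorff_prod; [exact: mfd_hausdorff|exact: rV_hausdorff].
  + by apply: compact_setX => //; exact: compact_set1.
  + by move=> [y u] /= /AK Ky; split=> //=; rewrite thinmx0.
- rewrite setIT; apply/seteqP; split=> [y Ay|_ [[y u] /= Ay <-]//].
  by exists (y, 0).
Qed.

Lemma op_sa0 : op_sa (set0 : set X).
Proof.
split; first exact: open0.
apply: (@semianalytic_subanalytic _ set0) => //; first exact: compact0.
apply: semianalytic_fin => p; have [c hc dc] := atlas_cover p.1.
exists c, [set q | chart_dom c q.1], void, void, (fun _ _ _ => 0), (fun _ _ => true).
split=> //; last by move=> q _; split=> // -[[]].
by apply: nbhs_fst; apply: open_nbhs_nbhs; split=> //; exact: chart_dom_open.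
Qed.

Definition rc_op_sa (N : set X) : Prop := op_sa N /\ compact (closure N).

(** [N] is an open coordinate cube and [K] the closed one. Semianalyticity must hold around every
    point of X, including those outside the chart; there it follows from [K] being closed. *)
Lemma rc_op_sa_nbhs (x : X) (O : set X) : nbhs x O ->
  exists N, [/\ rc_op_sa N, N x & closure N `<=` O].
Proof.
move=> nO; have [c hc dx] := atlas_cover x.
pose a := chart_map c x.
have [e e0 he] : exists2 e : R, 0 < e &
    forall u : 'rV[R]_(chart_dim c), (forall i, `|u 0 i - a 0 i| <= e) ->
      (chart_map c @` chart_dom c) u /\ O (chart_inv c u).
  have n1 : nbhs a (chart_map c @` chart_dom c).
    by apply: open_nbhs_nbhs; split; [exact: chart_im_open|exists x].
  have n2 : nbhs a (chart_inv c @^-1` O).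
    by apply: (chart_inv_continuous dx); rewrite chart_mapK.
  have n12 : nbhs a ((chart_map c @` chart_dom c) `&` (chart_inv c @^-1` O)).
    exact: filterI n1 n2.
  have /nbhs_ballP [e /= e0 he] := n12.
  exists (e / 2); first lra.
  move=> u hu; apply: he; split=> // i j; rewrite ord1 /ball /= distrC.
  by apply: le_lt_trans (hu j) _; lra.
pose Q := [set u : 'rV[R]_(chart_dim c) | forall i, `|u 0 i - a 0 i| <= e].
pose K := chart_inv c @` Q.
have cK : compact K.
  apply: continuous_compact.
    apply: continuous_in_subspaceT => u; rewrite inE => Qu.
    have [[y dy <-] _] := he u Qu; exact: chart_inv_continuous.
  rewrite (_ : Q = [set v | forall i, (`[a 0 i - e, a 0 i + e]%classic : set R) (v 0 i)]).
    exact: (@rV_compact R _ (fun i => `[a 0 i - e, a 0 i + e]%classic)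
      (fun i => @segment_compact _ _ _)).
  apply/seteqP; split=> u h i; have := h i;
    by rewrite /= in_itv /= ler_distl.
have KD : K `<=` chart_dom c.
  by move=> _ [u Qu <-]; have [[y dy <-] _] := he u Qu; rewrite chart_mapK.
have KO : K `<=` O by move=> _ [u Qu <-]; have [] := he u Qu.
pose N := [set y | chart_dom c y /\ forall i, `|chart_map c y 0 i - a 0 i| < e].
have NK : N `<=` K.
  move=> y [dy hy]; exists (chart_map c y); last exact: chart_mapK.
  by move=> i; exact: ltW.
have hX := @mfd_hausdorff _ X.
have oN : open N.
  rewrite openE => y [dy hy]; apply: filterI.
    by apply: open_nbhs_nbhs; split=> //; exact: chart_dom_open.
  have h i : \forall z \near y, `|chart_map c z 0 i - a 0 i| < e.
    have cc : (fun z => chart_map c z 0 i) @ y --> chart_map c y 0 i.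
      apply: (cvg_comp (chart_map c) (fun u : 'rV[R]__ => u 0 i)).
        exact: chart_map_continuous.
      exact: coord_continuous.
    have /cvgrPdist_lt := cc.
    move=> /(_ (e - `|chart_map c y 0 i - a 0 i|)); rewrite subr_gt0 => /(_ (hy i)).
    apply: filterS => z; rewrite ltrBrDr distrC; apply: le_lt_trans.
    by rewrite -[X in `|X|](subrKA (chart_map c y 0 i)) ler_normD.
  exact: filter_forall h.
exists N; split; last exact: subset_trans (closure_sub_compact hX cK NK) KO.
  split; last exact: compact_closure_sub NK.
  split=> //; apply: (semianalytic_subanalytic cK NK).
  (* Off [K] the set [N] is locally empty, hence described by the union over [void]. *)
  apply: semianalytic_fin => p; have [Kp|Kp] := pselect (K p.1); last first.
    have [c' hc' dc'] := atlas_cover p.1.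
    exists c', [set q | chart_dom c' q.1 /\ ~ K q.1], void, void, (fun _ _ _ => 0),
        (fun _ _ => true).
    split=> //; last 1 first.
    - by move=> q [_ nK]; split=> [/NK//|[[]]].
    - apply: (@nbhs_fst _ _ p [set y | chart_dom c' y /\ ~ K y]); apply: filterI.
        by apply: open_nbhs_nbhs; split=> //; exact: chart_dom_open.
      apply: open_nbhs_nbhs; split=> //.
      by apply: closed_openC; exact: compact_closed.
    - by move=> q [].
  (* The two signs turn the condition [|w i - a i| < e] into two strict affine inequalities. *)
  pose sg (b : bool) : R := if b then 1 else -1.
  exists c, [set q | chart_dom c q.1], unit, ('I_(chart_dim c) * bool)%type,
   (fun _ j w => (e + sg j.2 * a 0 j.1) + (- sg j.2) * w 0 (lshift 0 j.1)), (fun _ _ =>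
       true).
  split=> //.
  - by apply: nbhs_fst; apply: open_nbhs_nbhs;
      split; [exact: chart_dom_open|exact: KD].
  - by move=> q _ j _; exact: analytic_at_affine.
  - move=> q dq; split=> [[_ h]|[_ h]].
      exists tt => -[i b]; have := h i; rewrite ltr_norml => /andP[].
      by rewrite /prod_coord row_mxEl /sg; case: b => /=; lra.
    split=> // i; rewrite ltr_norml; have := h (i, true); have := h (i, false).
    by rewrite /= /prod_coord row_mxEl /=; lra.
by split=> // i; rewrite subrr normr0.
Qed.

Lemma rc_op_sa0 : rc_op_sa (set0 : set X).
Proof. by split; [exact: op_sa0|rewrite closure0; exact: compact0]. Qed.

(** Each basic open set contained in some good set is assigned one such set, any other basic open
    set is assigned [set0]. A point of [V] has a good neighbourhood, which contains a basic open set
    around the point; the set assigned to the latter covers the point. *)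
Lemma countable_rc_cover (V : set X) : open V ->
  exists N : nat -> set X,
    (forall i, rc_op_sa (N i) /\ closure (N i) `<=` V) /\
    V = \bigcup_i N i.
Proof.
move=> oV; have [B cB [Bo hB]] := @mfd_second_countable _ X.
pose good N := rc_op_sa N /\ closure N `<=` V.
have exN b : exists N', good N' /\ ((exists2 N, good N & b `<=` N) -> b `<=` N').
  have [[N gN bN]|h] := pselect (exists2 N, good N & b `<=` N).
    by exists N.
  by exists set0; split=> //; split; [exact: rc_op_sa0|rewrite closure0].
have [Nf hNf] := choice exN.
have /countable_injP [f finj] := cB.
(* By injectivity of [f] at most one [b] has number [i]; the union is a way to give [set0] to the
   numbers not taken. *)
exists (fun i => \bigcup_(b in [set b | B b /\ f b = i]) Nf b).
have E i : (exists b, [/\ B b, f b = i & \bigcup_(b in [set b | B b /\ f b = i]) Nf b =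
    Nf b])
    \/ \bigcup_(b in [set b | B b /\ f b = i]) Nf b = set0.
  have [[b [Bb fb]]|h] := pselect (exists b, B b /\ f b = i); [left|right].
    exists b; split=> //; apply/seteqP; split=> [y [b' [Bb' fb'] h]|y h];
        last by exists b.
    by rewrite (_ : b = b') //; apply: finj; rewrite ?inE // fb fb'.
  by rewrite -subset0 => y [b [Bb fb]] _; apply: h; exists b.
split=> [i|].
  have [[b [_ _ ->]]|->] := E i; first exact: (hNf b).1.
  by split; [exact: rc_op_sa0|rewrite closure0].
apply/seteqP; split=> [y Vy|y [i _ [b _]]]; last first.
  by move=> /subset_closure; exact: (hNf b).1.2.
have nV : nbhs y V by apply: open_nbhs_nbhs.
have [N [rN Ny NV]] := rc_op_sa_nbhs nV.
have /hB [b [Bb yb] bN] : nbhs y N by apply: open_nbhs_nbhs; split=> //; case: rN => -[].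
exists (f b) => //; exists b => //; apply: (hNf b).2 => //.
by exists N.
Qed.

End SubanalyticSets.

(** * The topology of the site and its points *)

Section SiteTopology.
Variables (R : realType) (X S : analyticManifold R).
Implicit Types (W : set (X * S)) (T : set (set (X * S))).

Lemma site_openP W : site_open W <->
  exists D : set (set X * set S), [/\ finite_set D,
    forall d, D d -> op_sa d.1 /\ open d.2 &
    W = \bigcup_(d in D) (d.1 `*` d.2)].
Proof.
split=> [[k [U [V [hUV ->]]]]|[D [/finite_seqP [s ->] hD ->]]].
  exists (range (fun i => (U i, V i))); split.
  - exact: finite_image.
  - by move=> _ [i _ <-]; exact: hUV.
  - by rewrite bigcup_image.
pose d i := nth (set0, set0) s i.
exists (size s), (fun i => (d i).1), (fun i => (d i).2); split=> [i|].
  by apply: hD; rewrite /= mem_nth.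
apply/seteqP; split=> [q [e /= es eq]|q [i _ h]]; last first.
  by exists (d i) => //=; rewrite mem_nth.
have es' : (index e s < size s)%N by rewrite index_mem.
by exists (Ordinal es') => //; rewrite /d /= nth_index.
Qed.

Lemma site_open_bigcup (D : set (set X * set S)) : finite_set D ->
  (forall d, D d -> op_sa d.1 /\ open d.2) ->
  site_open (\bigcup_(d in D) (d.1 `*` d.2)).
Proof. by move=> fD hD; apply/site_openP; exists D. Qed.

Lemma site_open0 : site_open (set0 : set (X * S)).
Proof.
rewrite -(bigcup_set0 (fun d : set X * set S => d.1 `*` d.2)).
exact: site_open_bigcup.
Qed.

Lemma site_openU W W' : site_open W -> site_open W' -> site_open (W `|` W').
Proof.
move=> /site_openP [D [fD hD ->]] /site_openP [D' [fD' hD' ->]].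
rewrite -bigcup_setU; apply: site_open_bigcup => [|d [/hD|/hD']] //.
by rewrite finite_setU.
Qed.

Lemma site_openI W W' : site_open W -> site_open W' -> site_open (W `&` W').
Proof.
move=> /site_openP [D [fD hD ->]] /site_openP [D' [fD' hD' ->]].
apply/site_openP; exists [set (d.1 `&` d'.1, d.2 `&` d'.2) | d in D & d' in D'].
split; first exact: finite_image2.
  move=> _ [d /hD [? ?] [d' /hD' [? ?] <-]]; split; [exact: op_saI|exact: openI].
apply/seteqP;
    split=> [q [[d Dd [? ?]] [d' Dd' [? ?]]]|q [_ [d Dd [d' Dd' <-]] [[? ?] [? ?]]]].
  by exists (d.1 `&` d'.1, d.2 `&` d'.2); [exists d => //; exists d'|].
by split; [exists d|exists d'].
Qed.

Lemma site_open_bigcup_set (T : set (set (X * S))) : finite_set T ->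
  T `<=` site_open (S := S) (X := X) -> site_open (\bigcup_(t in T) t).
Proof.
move: T; apply: finite_set_ind => [|t T fT IH] h.
  by rewrite bigcup_set0; exact: site_open0.
rewrite bigcup_setU1; apply: site_openU; first by apply: h; left.
by apply: IH => t' Tt'; apply: h; right.
Qed.

(** As [W] is a finite union of rectangles, intersecting the second factors that contain [v] gives
    one [B] valid for all [x] at once. *)
Lemma tube W (A : set X) (v : S) : site_open W ->
  (forall x, A x -> W (x, v)) -> exists B, [/\ open B, B v & A `*` B `<=` W].
Proof.
move=> /site_openP [D [fD hD ->]] hA.
exists (\bigcap_(d in [set d | D d /\ d.2 v]) d.2); split.
- apply: open_finite_bigcap; first by apply: sub_finite_set fD => d [].
  by move=> d [/hD []].
- by move=> d [].
- move=> [x w] [/= /hA [d Dd [dx dv]] hw]; exists d => //; split=> //=.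
  exact: hw.
Qed.

Lemma tube_set W (A : set X) (L : set S) : site_open W ->
  A `*` L `<=` W -> exists O, [/\ open O, L `<=` O & A `*` O `<=` W].
Proof.
move=> hW hAL; exists (\bigcup_(B in [set B | open B /\ A `*` B `<=` W]) B); split.
- by apply: bigcup_open => B [].
- move=> v Lv; have [|B [oB Bv AB]] := @tube W A v hW; first by move=> x Ax; exact: hAL.
  by exists B.
- by move=> [x v] [/= Ax [B [_ AB] Bv]]; exact: AB.
Qed.

Lemma covering_prod_refines T T' U V :
  refines T T' -> covering_prod T U V -> covering_prod T' U V.
Proof.
move=> h [Sg [Tt [h1 h2 h3]]]; exists Sg, Tt; split=> // t /h3 [t' /h [t'' ? ?] ?].
by exists t'' => //; apply: subset_trans; eauto.
Qed.

(** The refining rectangles already lie in [U x V], so restricting [T] to it changes nothing. *)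
Lemma coveringP T W : covering T W <->
  (forall t, T t -> site_open t /\ t `<=` W) /\
  forall U V, op_sa U -> open V -> U `*` V `<=` W -> covering_prod T U V.
Proof.
split=> -[h1 h2]; split=> // U V oU oV UV.
  apply: covering_prod_refines (h2 U V oU oV UV) => _ [t Tt <-].
  by exists t.
have [Sg [Tt [hS hT hr]]] := h2 U V oU oV UV.
exists Sg, Tt; split=> // _ [A SA [B TB <-]].
have [t ht st] := hr (A `*` B) (ex_intro2 _ _ A SA (ex_intro2 _ _ B TB erefl)).
exists (t `&` (U `*` V)); first by exists t.
move=> [x v] [/= Ax Bv]; split; first exact: st.
by split=> /=; [exact: (hS.1 A SA).2|rewrite -hT.2; exists B].
Qed.

Lemma covering_prodE T W U V : covering T W ->
  op_sa U -> open V -> U `*` V `<=` W -> exists Sg Tt,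
    [/\ sa_covering Sg U, open_covering Tt V &
        forall A B, Sg A -> Tt B -> exists2 t, T t & A `*` B `<=` t].
Proof.
move=> /coveringP [_ h] oU oV UV; have [Sg [Tt [hS hT hr]]] := h U V oU oV UV.
exists Sg, Tt; split=> // A B SA TB.
exact: hr (A `*` B) (ex_intro2 _ _ A SA (ex_intro2 _ _ B TB erefl)).
Qed.

Lemma covering_sub T W q : site_open W -> covering T W -> W q ->
  exists2 t, T t & t q.
Proof.
move=> /site_openP [D [fD hD WE]] hT; rewrite WE => -[d Dd [dq1 dq2]].
have [dX dS] := hD d Dd.
have dW : d.1 `*` d.2 `<=` W by rewrite WE => q' hq'; exists d.
have [Sg [Tt [hS hTt hr]]] := covering_prodE hT dX dS dW.
have [Sg0 [_ sS hK]] := hS.2 [set q.1] (@compact_set1 _ _).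
have [_ [A SA Aq]] : ([set q.1] `&` \bigcup_(A in Sg0) A) q.1 by rewrite hK.
have [B TB Bq] : (\bigcup_(B in Tt) B) q.2 by rewrite hTt.2.
have [t Ttt st] := hr A B (sS _ SA) TB; exists t => //.
by rewrite (surjective_pairing q); exact: st.
Qed.

(* A point x of U selects the intersection of U with all first factors
   containing x, and likewise on V; there are finitely many of these sets. *)
Lemma covering_prod_finite (D : set (set X * set S)) (U : set X) (V : set S) :
  finite_set D -> (forall d, D d -> op_sa d.1 /\ open d.2) ->
  op_sa U -> open V -> U `*` V `<=` \bigcup_(d in D) (d.1 `*` d.2) ->
  covering_prod [set d.1 `*` d.2 | d in D] U V.
Proof.
move=> fD hD oU oV UV.
pose cutX (E : set (set X * set S)) := U `&` \bigcap_(d in E) d.1.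
pose cutS (E : set (set X * set S)) := V `&` \bigcap_(d in E) d.2.
have osaE E : finite_set E -> E `<=` D -> op_sa (cutX E).
  move: E; apply: finite_set_ind => [|d E fE IH] sE.
    by rewrite /cutX bigcap_set0 setIT.
  rewrite /cutX bigcap_setU1 setICA; apply: op_saI.
    by apply: (hD d _).1; apply: sE; left.
  by apply: IH => d' Ed'; apply: sE; right.
pose DX x := [set d | D d /\ d.1 x]; pose DS v := [set d | D d /\ d.2 v].
exists [set cutX (DX x) | x in U], [set cutS (DS v) | v in V]; split.
- split=> [_ [x Ux <-]|K cK].
    split; last by move=> y [].
    by apply: osaE => [|d []//]; apply: sub_finite_set fD => d [].
  exists [set cutX (DX x) | x in U]; split=> //.
    apply: sub_finite_set (finite_image cutX (finite_powerset fD)) => _ [x Ux <-].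
    by exists (DX x) => // d [].
  congr (_ `&` _); apply/seteqP; split=> [y [_ [x Ux <-] []]//|y Uy].
  by exists (cutX (DX y)); [exists y|split=> // d []].
- split=> [_ [v Vv <-]|].
    apply: openI => //; apply: open_finite_bigcap.
      by apply: sub_finite_set fD => d [].
    by move=> d [/hD []].
  apply/seteqP; split=> [y [_ [x Ux <-] []]//|y Uy].
  by exists (cutS (DS y)); [exists y|split=> // d []].
- move=> _ [_ [x Ux <-] [_ [v Vv <-] <-]].
  have [d Dd [dx dv]] := UV (x, v) (conj Ux Vv).
  exists (d.1 `*` d.2); first by exists d.
  by move=> [y w] [/= [_ hy] [_ hw]]; split; [exact: hy|exact: hw].
Qed.

Lemma covering_finite T : finite_set T -> (forall t, T t -> site_open t) ->
  covering T (\bigcup_(t in T) t).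
Proof.
move=> fT oT; apply/coveringP; split=> [t Tt|U V oU oV UV].
  by split; [exact: oT|move=> q tq; exists t].
have /choice [D hD] : forall t, exists D : set (set X * set S), T t ->
    [/\ finite_set D, forall d, D d -> op_sa d.1 /\ open d.2 &
    t = \bigcup_(d in D) (d.1 `*` d.2)].
  move=> t; have [Tt|nTt] := pselect (T t); last by exists set0.
  by have /site_openP [D hD] := oT t Tt; exists D.
apply: (@covering_prod_refines [set d.1 `*` d.2 | d in \bigcup_(t in T) D t]).
  move=> _ [d [t Tt Dd] <-]; exists t => //.
  by have [_ _ tE] := hD t Tt; rewrite tE => q dq; exists d.
apply: covering_prod_finite => //.
- by apply: bigcup_finite => // t /hD [].
- by move=> d [t /hD [_ h _] /h].
- move=> q /UV [t Tt]; have [_ _ tE] := hD t Tt; rewrite tE => -[d Dd dq].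
  by exists d => //; exists t.
Qed.

(** The finite subfamily comes from covering the whole of [K], and not just its trace on [U], by the
    sets of [C]. *)
Lemma sa_covering_cap (U : set X) (C : set (set X)) :
  op_sa U -> (forall N, C N -> op_sa N) -> (forall x, exists2 N, C N & N x) ->
  sa_covering [set U `&` N | N in C] U.
Proof.
move=> oU oC hC; split=> [_ [N CN <-]|K cK].
  by split; [apply: op_saI => //; exact: oC|move=> x []].
have [||D [fD sD hD]] := @compact_finite_subcover X K C cK.
- by move=> N /oC [].
- by move=> x _; have [N CN Nx] := hC x; exists N.
exists [set U `&` N | N in D]; split; first exact: finite_image.
  by move=> _ [N /sD rN <-]; exists N.
apply/seteqP; split=> [x [Kx [_ [N _ <-] []]]//|x [Kx Ux]]; split=> //.
by have [N DN Nx] := hD x Kx; exists (U `&` N); [exists N|].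
Qed.

Lemma sa_covering_rc (U : set X) : op_sa U ->
  sa_covering [set U `&` N | N in rc_op_sa (X := X)] U.
Proof.
move=> oU; apply: sa_covering_cap => // [N []//|x].
by have [N [rN Nx _]] := rc_op_sa_nbhs (@filterT _ (nbhs x) _); exists N.
Qed.

(* The explicit form of weak quasi-compactness; it is equivalent to [wc] (see
   [wcP]), but visibly stable under intersection and interpolation. *)
Definition way_below W W' : Prop :=
  exists D : set (set X * set S), [/\ finite_set D,
    forall d, D d -> [/\ rc_op_sa d.1, open d.2, compact (closure d.2) &
      d.1 `*` closure d.2 `<=` W'] &
    W `<=` \bigcup_(d in D) (d.1 `*` d.2)].

Lemma way_below_sub V W : way_below V W -> V `<=` W.
Proof.
move=> [D [_ hD VD]] q /VD [d /hD [_ _ _ h] [q1 q2]]; apply: h; split=> //.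
exact: subset_closure.
Qed.

Lemma way_below_le V V' W W' :
  V `<=` V' -> W' `<=` W -> way_below V' W' -> way_below V W.
Proof.
move=> sV sW [D [fD hD VD]]; exists D; split=> //; last exact: subset_trans VD.
by move=> d /hD [? ? ? h]; split=> //; exact: subset_trans sW.
Qed.

Lemma way_below0 W : way_below set0 W.
Proof. by exists set0; split. Qed.

Lemma way_belowU V V' W W' : way_below V W -> way_below V' W' ->
  way_below (V `|` V') (W `|` W').
Proof.
move=> [D [fD hD VD]] [D' [fD' hD' VD']]; exists (D `|` D'); split.
- by rewrite finite_setU.
- move=> d [/hD|/hD'] [? ? ? h]; split=> // q /h ?; [left|right]; assumption.
- move=> q [/VD|/VD'] [d ? ?]; exists d => //; [left|right]; assumption.
Qed.

Lemma rc_op_saI (A B : set X) : rc_op_sa A -> op_sa B -> rc_op_sa (A `&` B).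
Proof.
move=> [oA cA] oB; split; first exact: op_saI.
apply: (compact_closure_sub (@mfd_hausdorff _ X) cA) => x [Ax _].
exact: subset_closure.
Qed.

Lemma way_belowI V V' W W' : way_below V W -> way_below V' W' ->
  way_below (V `&` V') (W `&` W').
Proof.
move=> [D [fD hD VD]] [D' [fD' hD' VD']].
exists [set (d.1 `&` d'.1, d.2 `&` d'.2) | d in D & d' in D']; split.
- exact: finite_image2.
- move=> _ [d /hD [r1 o1 c1 h1] [d' /hD' [r2 o2 c2 h2] <-]] /=; split.
  + by apply: rc_op_saI => //; case: r2.
  + exact: openI.
  + apply: (compact_closure_sub (@mfd_hausdorff _ S) c1) => x [Ax _].
    exact: subset_closure.
  + move=> [x v] [/= [x1 x2] hv]; split; [apply: h1|apply: h2]; split=> //=.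
      by apply: closure_subset hv => ? [].
    by apply: closure_subset hv => ? [].
- move=> q [/VD [d Dd [? ?]] /VD' [d' Dd' [? ?]]].
  by exists (d.1 `&` d'.1, d.2 `&` d'.2); [exists d => //; exists d'|].
Qed.

Lemma compact_open_between (L O : set S) : compact L -> open O -> L `<=` O ->
  exists B, [/\ open B, L `<=` B, compact (closure B) & closure B `<=` O].
Proof.
move=> cL oO LO.
have [||D [fD sD hD]] := @compact_finite_subcover S L
    [set N | rc_op_sa N /\ closure N `<=` O] cL.
- by move=> N [[[]]].
- move=> v /LO Ov; have nO : nbhs v O by apply: open_nbhs_nbhs.
  by have [N [rN Nv NO]] := rc_op_sa_nbhs nO; exists N.
have cK : compact (\bigcup_(N in D) closure N).
  move: D fD sD {hD}; apply: finite_set_ind => [_|N D fD IH sD].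
    by rewrite bigcup_set0; exact: compact0.
  rewrite bigcup_setU1; apply: compactU.
    by have [[_ ?] _] := sD N (or_introl erefl).
  by apply: IH => N' DN'; apply: sD; right.
have sub : \bigcup_(N in D) N `<=` \bigcup_(N in D) closure N.
  by move=> x [N DN Nx]; exists N => //; exact: subset_closure.
have hS := @mfd_hausdorff _ S.
exists (\bigcup_(N in D) N); split=> //.
- by apply: bigcup_open => N /sD [[[]]].
- exact: compact_closure_sub hS cK sub.
- by move=> x /(closure_sub_compact hS cK sub) [N /sD [_ h] /h].
Qed.

(** Only the second factors grow: around [d.1 x closure d.2] there is a tube inside [W], and
    [closure d.2] has a relatively compact neighbourhood whose closure stays in that tube. *)
Lemma way_below_interpolate V W : site_open W -> way_below V W ->
  exists W', [/\ site_open W', way_below V W' & way_below W' W].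
Proof.
move=> oW [D [fD hD VD]].
have /choice [B hB] : forall d, exists B, D d ->
    [/\ open B, closure d.2 `<=` B, compact (closure B) & d.1 `*` closure B `<=` W].
  move=> d; have [Dd|nDd] := pselect (D d); last by exists set0.
  have [_ _ c2 dW] := hD d Dd; have [Q [Oopen LQ QW]] := tube_set oW dW.
  have [B [oB LB cB BQ]] := compact_open_between c2 Oopen LQ.
  exists B => _; split=> // -[x v] [/= dx /BQ Qv]; exact: QW.
exists (\bigcup_(d in D) (d.1 `*` B d)); split.
- rewrite -(bigcup_image _ (fun d => (d.1, B d)) (fun d => d.1 `*` d.2)).
  apply: site_open_bigcup; first exact: finite_image.
  by move=> _ [d Dd <-]; have [[]] := hD d Dd; have [] := hB d Dd.
- exists D; split=> // d Dd; have [? ? ? ?] := hD d Dd; split=> // q [dq cq].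
  by exists d => //; split=> //; have [_ h _ _] := hB d Dd; exact: h.
- exists [set (d.1, B d) | d in D]; split; first exact: finite_image.
    by move=> _ [d Dd <-]; have [] := hD d Dd; have [] := hB d Dd.
  by rewrite bigcup_image.
Qed.

(** One direction tests [wc] on the covering of [W] by the rectangles allowed in [way_below]. In the
    other, a product covering of a neighbourhood of [d.1 x closure d.2] has a finite part covering
    it, from the compactness of [closure d.1] for the first factors and of [closure d.2] for the
    second. *)
Lemma wcP (V W : op X S) : wc V W <-> way_below V W.
Proof.
split=> [[VW hwc]|VW].
  pose T := [set t : set (X * S) | exists A B, [/\ rc_op_sa A, open B,
    compact (closure B), A `*` closure B `<=` W & t = A `*` B]].
  have [|T' [fT' cT' rT']] := hwc T.
    apply/coveringP; split=> [_ [A [B [[oA _] oB _ sW ->]]]|U O oU oO UO].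
      split; first exact: site_open_prod.
      by move=> [x v] [/= Ax Bv]; apply: sW; split=> //; exact: subset_closure.
    exists [set U `&` N | N in rc_op_sa (X := X)],
      [set B | [/\ open B, compact (closure B) & closure B `<=` O]]; split.
    - exact: sa_covering_rc.
    - split=> [B []//|]; apply/seteqP; split=> [v [B [_ _ BO] Bv]|v Ov].
        by apply: BO; exact: subset_closure.
      have nO : nbhs v O by apply: open_nbhs_nbhs.
      by have [N [[[? _] ?] Nv NO]] := rc_op_sa_nbhs nO; exists N.
    - move=> _ [_ [N rN <-] [B [oB cB BO] <-]]; exists ((U `&` N) `*` B) => //.
      exists (U `&` N), B; split=> //; first by rewrite setIC; exact: rc_op_saI.
      by move=> [x v] [/= [Ux _] /BO Ov]; exact: UO.
  have /choice [d hd] : forall t, exists d : set X * set S, T' t ->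
      [/\ rc_op_sa d.1, open d.2, compact (closure d.2),
          d.1 `*` closure d.2 `<=` W & t `<=` d.1 `*` d.2].
    move=> t; have [T't|nT't] := pselect (T' t); last by exists (set0, set0).
    have [_ [_ [A [B [? ? ? ? ->]]] <-] st] := rT' t T't.
    by exists (A, B) => _; split=> //; apply: subset_trans st _ => q [].
  exists [set d t | t in T']; split; first exact: finite_image.
    by move=> _ [t T't <-]; have [] := hd t T't.
  move=> q Vq; have [t T't tq] := covering_sub (op_site_open V) cT' Vq.
  by exists (d t); [exists t|have [_ _ _ _ h] := hd t T't; exact: h].
split; first exact: way_below_sub.
move=> T cT; have [D [fD hD VD]] := VW.
have /choice [E hE] : forall d : set X * set S, exists E : set (set X * set S), D d ->
    [/\ finite_set E, forall e, E e -> [/\ op_sa e.1, open e.2 &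
        exists2 t, T t & e.1 `*` e.2 `<=` t] &
      d.1 `*` d.2 `<=` \bigcup_(e in E) (e.1 `*` e.2)].
  move=> d; have [Dd|nDd] := pselect (D d); last by exists set0.
  have [[dX c1] dS c2 dW] := hD d Dd.
  (* Product coverings exist only over open rectangles, so [closure d.2] is first enlarged to an
     open [Q]. *)
  have [Q [Oopen LQ QW]] := tube_set (op_site_open W) dW.
  have [Sg [Tt [hS hT hr]]] := covering_prodE cT dX Oopen QW.
  have [Sg0 [fS sS hS0]] := hS.2 _ c1.
  have [|Tt0 [fT sT hT0]] := @compact_finite_subcover S _ Tt c2 hT.1.
    by rewrite hT.2.
  exists (Sg0 `*` Tt0) => _; split; first exact: finite_setX.
    move=> e [/sS e1 /sT e2]; split; [exact: (hS.1 _ e1).1|exact: hT.1|exact: hr].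
  move=> [x v] [/= dx dv].
  have [_ [A SA Ax]] : (closure d.1 `&` \bigcup_(A in Sg0) A) x.
    by rewrite hS0; split=> //; exact: subset_closure.
  by have [B TB Bv] := hT0 v (subset_closure dv); exists (A, B).
pose T' := [set (e.1 `*` e.2) `&` V | e in \bigcup_(d in D) E d].
have fT' : finite_set T'.
  by apply: finite_image; apply: bigcup_finite => // d /hE [].
have oT' t : T' t -> site_open t.
  move=> [e [d Dd Ee] <-]; apply: site_openI; last exact: op_site_open.
  by have [_ /(_ e Ee) [? ? _] _] := hE d Dd; exact: site_open_prod.
exists T'; split=> //.
  have -> : (V : set _) = \bigcup_(t in T') t; last exact: covering_finite.
  apply/seteqP; split=> [q Vq|q [_ [e _ <-] []]//].
  have [d Dd dq] := VD q Vq; have [_ _ h] := hE d Dd; have [e Ee eq] := h q dq.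
  by exists ((e.1 `*` e.2) `&` V) => //; exists e => //; exists d.
move=> _ [e [d Dd Ee] <-]; have [_ /(_ e Ee) [_ _ [t Tt et]] _] := hE d Dd.
by exists (t `&` V); [exists t|move=> q [/et]].
Qed.

End SiteTopology.

(** * Points of the site *)

Section Points.
Variables (R : realType) (X S : analyticManifold R).

Record site_point := SitePoint {
  pt_ultra : set_system X;
  pt_base : S;
  pt_ultraP : UltraFilter pt_ultra;
  pt_compact : exists2 K, compact K & pt_ultra K }.

Definition pin (p : site_point) (W : set (X * S)) : Prop :=
  pt_ultra p [set x | W (x, pt_base p)].

Lemma ultra_bigcup (T I : Type) (F : set_system T) (D : set I) (f : I -> set T) :
  UltraFilter F -> finite_set D -> F (\bigcup_(i in D) f i) ->
  exists2 i, D i & F (f i).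
Proof.
move=> hF fD; apply: contraPP => h hU.
have PF : ProperFilter F by case: hF.
have : F (\bigcap_(i in D) ~` f i).
  have : finite_set (f @` D) by exact: finite_image.
  rewrite -(bigcap_image D f (fun A => ~` A)).
  have : forall A, (f @` D) A -> F (~` A).
    move=> _ [i Di <-]; have [Ffi|//] := in_ultra_setVsetC (f i) hF.
    by exfalso; apply: h; exists i.
  move=> + fE; move: (f @` D) fE; apply: finite_set_ind => [_|A E _ IH hE].
    by rewrite bigcap_set0; exact: filterT.
  rewrite bigcap_setU1; apply: filterI; first by apply: hE; left.
  by apply: IH => B EB; apply: hE; right.
move=> /(filterI hU) /filter_ex [x [[i Di fx] /(_ i Di)]]; exact.
Qed.

Lemma pinI p W W' : pin p W -> pin p W' -> pin p (W `&` W').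
Proof. by move=> h h'; have ? := pt_ultraP p; exact: filterI. Qed.

Lemma pin_sub p W W' : W `<=` W' -> pin p W -> pin p W'.
Proof. by move=> s pW; have ? := pt_ultraP p; apply: filterS pW => x; exact: s. Qed.

(** The ultrafilter selects first one of the finitely many rectangles of [W], then, thanks to its
    compact member, one of finitely many first factors of the covering; the base point selects the
    second factor. *)
Lemma pin_covering p T W : site_open W -> covering T W -> pin p W ->
  exists2 t, T t & pin p t.
Proof.
move=> /site_openP [D [fD hD WE]] cT; have uF := pt_ultraP p.
rewrite /pin; set v := pt_base p => pW.
have : pt_ultra p (\bigcup_(d in [set d | D d /\ d.2 v]) d.1).
  by apply: filterS pW => x; rewrite WE => -[d Dd [dx dv]]; exists d.
move=> /ultra_bigcup [] //; first by apply: sub_finite_set fD => d [].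
move=> d [Dd dv] pd; have [dX dS] := hD d Dd.
have dW : d.1 `*` d.2 `<=` W by rewrite WE => q dq; exists d.
have [Sg [Tt [hS hT hr]]] := covering_prodE cT dX dS dW.
have [K cK pK] := pt_compact p; have [Sg0 [fS sS hK]] := hS.2 K cK.
have : pt_ultra p (\bigcup_(A in Sg0) A).
  by apply: filterS (filterI pK pd) => x; rewrite -hK => -[].
move=> /ultra_bigcup [] // A SA pA.
have [B TB Bv] : (\bigcup_(B in Tt) B) v by rewrite hT.2.
have [t Ttt st] := hr A B (sS _ SA) TB; exists t => //.
by apply: filterS pA => x Ax; exact: st.
Qed.

(* Otherwise the complements in A of the slices over v generate a proper
   filter, and an ultrafilter refining it gives a point meeting no member. *)
Lemma points_finite_cover (A : set X) (v : S) (T : set (set (X * S))) :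
  compact (closure A) ->
  (forall p, pt_base p = v -> pt_ultra p A -> exists2 t, T t & pin p t) ->
  exists T0, [/\ finite_set T0, T0 `<=` T &
    forall x, A x -> (\bigcup_(t in T0) t) (x, v)].
Proof.
move=> cA hp; apply: contrapT => h.
pose Fin := [set T0 | finite_set T0 /\ T0 `<=` T].
pose B (T0 : set (set (X * S))) := A `\` [set x | (\bigcup_(t in T0) t) (x, v)].
have FB : ProperFilter (filter_from Fin B).
  apply: filter_from_proper; last first.
    move=> T0 [fT sT]; apply: contrapT => hB; apply: h; exists T0; split=> // x Ax.
    by apply: contrapT => hx; apply: hB; exists x.
  apply: filter_from_filter; first by exists set0; split.
  move=> T1 T2 [f1 s1] [f2 s2]; exists (T1 `|` T2).
    by split; [rewrite finite_setU|move=> t [/s1|/s2]].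
  move=> x [Ax hx]; split; split=> // -[t Tt tx]; apply: hx; exists t => //;
      by [left|right].
have [G [uG sG]] := ultraFilterLemma FB.
have PG : ProperFilter G by case: uG.
have GA : G A by apply: sG; exists set0; [split|move=> x []].
have GK : exists2 K, compact K & G K.
  by exists (closure A) => //; apply: filterS GA; exact: subset_closure.
have [t Tt pt] := hp (@SitePoint G v uG GK) erefl GA.
have {}pt : G [set x | t (x, v)] by [].
have : G (B [set t]) by apply: sG; exists [set t] => //; split=> // _ ->.
move=> /(filterI pt) /filter_ex [x [/= tx [_]]]; apply.
by exists t.
Qed.

End Points.

(** * Modules and sheaves *)

Definition linear_pack (K : pzRingType) (U V : lmodType K) (f : U -> V)
    (hf : linear f) : {linear U -> V} :=
  HB.pack f (GRing.isLinear.Build K U V *:%R f hf).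

Section Submodule.
Variables (K : pzRingType) (M : lmodType K) (P : M -> Prop).

Definition submodule_pred : Prop :=
  P 0 /\ forall a x y, P x -> P y -> P (a *: x + y).

(** The closure proof is an argument of the type so that the module instances can be declared on
    it. *)
Definition submodule of submodule_pred : Type := {x | P x}.

Variable hP : submodule_pred.
Local Notation N := (submodule hP).

HB.instance Definition _ := gen_eqMixin N.
HB.instance Definition _ := gen_choiceMixin N.

Definition submodule_val (u : N) : M := sval u.
Local Notation val := submodule_val.

Lemma submodule_inj (u v : N) : val u = val v -> u = v.
Proof. by case: u v => [x Px] [y Py] /= xy; exact: eq_exist. Qed.

Let PD x y : P x -> P y -> P (x + y).
Proof. by move=> Px Py; rewrite -[x]scale1r; exact: hP.2. Qed.
Let PZ a x : P x -> P (a *: x).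
Proof. by move=> Px; rewrite -[_ *: _]addr0; apply: hP.2 => //; exact: hP.1. Qed.
Let PN x : P x -> P (- x).
Proof. by move=> Px; rewrite -scaleN1r; exact: PZ. Qed.

Let zero : N := exist _ 0 hP.1.
Let opp (u : N) : N := exist _ _ (PN (svalP u)).
Let add (u v : N) : N := exist _ _ (PD (svalP u) (svalP v)).
Let scale a (u : N) : N := exist _ _ (PZ a (svalP u)).

Let addA : associative add.
Proof. by move=> u v w; apply: submodule_inj; rewrite /= addrA. Qed.
Let addC : commutative add.
Proof. by move=> u v; apply: submodule_inj; rewrite /= addrC. Qed.
Let add0 : left_id zero add.
Proof. by move=> u; apply: submodule_inj; rewrite /= add0r. Qed.
Let addN : left_inverse zero opp add.
Proof. by move=> u; apply: submodule_inj; rewrite /= addNr. Qed.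
HB.instance Definition _ := GRing.isZmodule.Build N addA addC add0 addN.

Let scaleA a b u : scale a (scale b u) = scale (a * b) u.
Proof. by apply: submodule_inj; rewrite /= scalerA. Qed.
Let scale1 : left_id 1 scale.
Proof. by move=> u; apply: submodule_inj; rewrite /= scale1r. Qed.
Let scaleDr : right_distributive scale +%R.
Proof. by move=> a u v; apply: submodule_inj; rewrite /= scalerDr. Qed.
Let scaleDl u : {morph scale^~ u : a b / a + b}.
Proof. by move=> a b; apply: submodule_inj; rewrite /= scalerDl. Qed.
HB.instance Definition _ :=
  GRing.Zmodule_isLmodule.Build K N scaleA scale1 scaleDr scaleDl.

Lemma submodule_val_linear : linear val.
Proof. by []. Qed.

End Submodule.

Section ProductModule.
Variables (K : pzRingType) (I : Type) (M : I -> lmodType K).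

Definition prod_module : Type := forall i, M i.
Local Notation N := prod_module.

HB.instance Definition _ := gen_eqMixin N.
HB.instance Definition _ := gen_choiceMixin N.

Lemma prod_module_ext (u v : N) : (forall i, u i = v i) -> u = v.
Proof. exact: functional_extensionality_dep. Qed.

Let zero : N := fun=> 0.
Let opp (u : N) : N := fun i => - u i.
Let add (u v : N) : N := fun i => u i + v i.
Let scale a (u : N) : N := fun i => a *: u i.

Let addA : associative add.
Proof. by move=> u v w; apply: prod_module_ext => i; exact: addrA. Qed.
Let addC : commutative add.
Proof. by move=> u v; apply: prod_module_ext => i; exact: addrC. Qed.
Let add0 : left_id zero add.
Proof. by move=> u; apply: prod_module_ext => i; exact: add0r. Qed.
Let addN : left_inverse zero opp add.
Proof. by move=> u; apply: prod_module_ext => i; exact: addNr. Qed.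
HB.instance Definition _ := GRing.isZmodule.Build N addA addC add0 addN.

Let scaleA a b u : scale a (scale b u) = scale (a * b) u.
Proof. by apply: prod_module_ext => i; exact: scalerA. Qed.
Let scale1 : left_id 1 scale.
Proof. by move=> u; apply: prod_module_ext => i; exact: scale1r. Qed.
Let scaleDr : right_distributive scale +%R.
Proof. by move=> a u v; apply: prod_module_ext => i; exact: scalerDr. Qed.
Let scaleDl u : {morph scale^~ u : a b / a + b}.
Proof. by move=> a b; apply: prod_module_ext => i; exact: scalerDl. Qed.
HB.instance Definition _ :=
  GRing.Zmodule_isLmodule.Build K N scaleA scale1 scaleDr scaleDl.

End ProductModule.

Section QuotientModule.
Variables (K : pzRingType) (M : lmodType K) (P : M -> Prop).

(** An element is a coset, as a set, so that equality of classes is equality of sets. *)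
Definition quotient_module of submodule_pred P : Type :=
  {C : set M | exists x, C = [set y | P (y - x)]}.

Variable hP : submodule_pred P.
Local Notation Q := (quotient_module hP).

HB.instance Definition _ := gen_eqMixin Q.
HB.instance Definition _ := gen_choiceMixin Q.

Definition quotient_pi (x : M) : Q :=
  exist _ [set y | P (y - x)] (ex_intro _ x erefl).
Local Notation pi := quotient_pi.

Let PD x y : P x -> P y -> P (x + y).
Proof. by move=> Px Py; rewrite -[x]scale1r; exact: hP.2. Qed.
Let PZ a x : P x -> P (a *: x).
Proof. by move=> Px; rewrite -[_ *: _]addr0; apply: hP.2 => //; exact: hP.1. Qed.
Let PN x : P x -> P (- x).
Proof. by move=> Px; rewrite -scaleN1r; exact: PZ. Qed.

Lemma quotient_piP x y : pi x = pi y <-> P (x - y).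
Proof.
split=> [h|Pxy].
  suff : sval (pi x) x by rewrite h.
  by rewrite /= subrr; exact: hP.1.
apply: eq_exist; apply/seteqP; split=> z /= Pz.
  by rewrite -(subrKA x); exact: PD.
by rewrite -(subrKA y); apply: PD => //; rewrite -opprB; exact: PN.
Qed.

Let repr (C : Q) : M := sval (cid (svalP C)).
Let reprK C : pi (repr C) = C.
Proof. by case: C => C hC; apply: eq_exist; rewrite /repr /=; case: cid. Qed.
Let piK x : P (repr (pi x) - x).
Proof. by apply/quotient_piP; rewrite reprK. Qed.

Let opp (C : Q) : Q := pi (- repr C).
Let add (C D : Q) : Q := pi (repr C + repr D).
Let scale a (C : Q) : Q := pi (a *: repr C).

Let addE x y : add (pi x) (pi y) = pi (x + y).
Proof. by apply/quotient_piP; rewrite opprD addrACA; exact: PD. Qed.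
Let oppE x : opp (pi x) = pi (- x).
Proof. by apply/quotient_piP; rewrite -opprD; exact: PN. Qed.
Let scaleE a x : scale a (pi x) = pi (a *: x).
Proof. by apply/quotient_piP; rewrite -scalerBr; exact: PZ. Qed.

Let addA : associative add.
Proof.
by move=> C D E; rewrite -(reprK C) -(reprK D) -(reprK E) !addE addrA.
Qed.
Let addC : commutative add.
Proof. by move=> C D; rewrite -(reprK C) -(reprK D) !addE addrC. Qed.
Let add0 : left_id (pi 0) add.
Proof. by move=> C; rewrite -(reprK C) addE add0r. Qed.
Let addN : left_inverse (pi 0) opp add.
Proof. by move=> C; rewrite -(reprK C) oppE addE addNr. Qed.
HB.instance Definition _ := GRing.isZmodule.Build Q addA addC add0 addN.

Let scaleA a b C : scale a (scale b C) = scale (a * b) C.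
Proof. by rewrite -(reprK C) !scaleE scalerA. Qed.
Let scale1 : left_id 1 scale.
Proof. by move=> C; rewrite -(reprK C) scaleE scale1r. Qed.
Let scaleDr : right_distributive scale +%R.
Proof.
move=> a C D; rewrite -(reprK C) -(reprK D).
by rewrite [X in scale _ X]addE !scaleE [RHS]addE scalerDr.
Qed.
Let scaleDl C : {morph scale^~ C : a b / a + b}.
Proof.
by move=> a b; rewrite -(reprK C) !scaleE [RHS]addE scalerDl.
Qed.
HB.instance Definition _ :=
  GRing.Zmodule_isLmodule.Build K Q scaleA scale1 scaleDr scaleDl.

Lemma quotient_pi_linear : linear pi.
Proof.
move=> a x y; rewrite (_ : a *: pi x + pi y = add (scale a (pi x)) (pi y)) //.
by rewrite scaleE addE.
Qed.

End QuotientModule.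

(** * Gluing, subsheaves and morphisms *)

Section SheafBasics.
Variables (R : realType) (X S : analyticManifold R).
Implicit Types (F : sheaf X S) (W : op X S).

Lemma op_eq W W' : W = W' :> set (X * S) -> W = W'.
Proof. by case: W W' => [W h] [W' h'] /= E; subst W'; congr Op;
    exact: Prop_irrelevance. Qed.

Definition opI W W' : op X S := Op (site_openI (op_site_open W) (op_site_open W')).
Definition opU W W' : op X S := Op (site_openU (op_site_open W) (op_site_open W')).

Lemma res_eq (F : presheaf X S) W W' (h h' : W' `<=` W) (s : F W) :
  res F h s = res F h' s.
Proof. by rewrite (Prop_irrelevance h h'). Qed.

Section Family.
Variables (F : sheaf X S) (I : Type) (O : I -> op X S) (W : op X S).
Hypothesis cO : covering (range (fun i => op_set (O i))) W.

(** The sheaf condition takes one section per member of a set of opens, whereas a set may occur at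
    several indices. A member is sent to some [i] with [V] contained in [O i]; an inclusion, unlike
    an equality, moves sections by [res], and compatibility makes the choice irrelevant. *)
Lemma sheaf_glue (a : forall i, F (O i)) :
  (forall i j (h : opI (O i) (O j) `<=` O i) (h' : opI (O i) (O j) `<=` O j),
     res F h (a i) = res F h' (a j)) ->
  exists w : F W, forall i (h : O i `<=` W), res F h w = a i.
Proof.
move=> comp; pose T := range (fun i => op_set (O i)).
have comp' i j (V : op X S) (h : V `<=` O i) (h' : V `<=` O j) :
    res F h (a i) = res F h' (a j).
  have hI : V `<=` opI (O i) (O j) by move=> q Vq; split; [exact: h|exact: h'].
  have hi : opI (O i) (O j) `<=` O i by move=> q [].
  have hj : opI (O i) (O j) `<=` O j by move=> q [].
  by rewrite -(res_comp hi hI h) (comp _ _ hi hj) (res_comp hj hI h').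
have idx (V : op X S) (tV : T V) : {i | V `<=` O i}.
  by apply: cid; case: tV => i _ <-; exists i.
pose s (V : op X S) (tV : T V) : F V := let: exist i h := idx V tV in res F h (a i).
have hs : compatible s.
  move=> V1 V2 t1 t2 V h1 h2; rewrite /s.
  case: (idx V1 t1) => i hi; case: (idx V2 t2) => j hj.
  rewrite (res_comp hi h1 (subset_trans h1 hi)) (res_comp hj h2 (subset_trans h2 hj)).
  exact: comp'.
have [w [hw _]] := sheafP cO hs; exists w => i h.
have tO : T (O i) by exists i.
rewrite (hw _ tO) /s; case: (idx _ _) => j hj.
by rewrite (comp' j i _ hj (@subset_refl _ _)) res_id.
Qed.

Lemma sheaf_sep (w w' : F W) :
  (forall i (h : O i `<=` W), res F h w = res F h w') -> w = w'.
Proof.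
move=> hw; pose T := range (fun i => op_set (O i)).
have sW (V : op X S) (tV : T V) : V `<=` W by have [/(_ _ tV) []] := cO.
pose s (V : op X S) (tV : T V) : F V := res F (sW V tV) w.
have hs : compatible s.
  move=> V1 V2 t1 t2 V h1 h2; rewrite /s.
  by rewrite !(res_comp _ _ (subset_trans h1 (sW _ t1))).
have [u [_ hu]] := sheafP cO hs.
transitivity u; [symmetry|]; apply: hu => V tV h; rewrite /s.
  exact: res_eq.
have [i _ E] := tV; have {}E := @op_eq (O i) V E; subst V.
by rewrite (res_eq (sW _ tV) h) hw.
Qed.

End Family.

Lemma sheaf_eq0 (F : sheaf X S) (W : op X S) T (w : F W) : covering T W ->
  (forall (V : op X S) (i : V `<=` W), T V -> res F i w = 0) -> w = 0.
Proof.
move=> cT hw; pose I := {V : op X S | T V}.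
have E : range (fun i : I => op_set (sval i)) = T.
  apply/seteqP; split=> [_ [[V tV] _ <-]//|t Tt].
  have [/(_ _ Tt) [ot _] _] := cT.
  by exists (exist _ (Op ot) Tt).
rewrite -E in cT; apply: (sheaf_sep cT) => -[V tV] /= i.
by rewrite linear0 hw.
Qed.

Section Subsheaf.
Variables (F : sheaf X S) (P : forall W, F W -> Prop).
Hypothesis Psub : forall W, submodule_pred (@P W).
Hypothesis Pres : forall (W W' : op X S) (h : W' `<=` W) (s : F W), P s -> P (res F h s).
Hypothesis Ploc : forall (W : op X S) (T : set (set (X * S))) (w : F W),
  covering T W -> (forall (V : op X S) (h : V `<=` W), T V -> P (res F h w)) -> P w.

Let sect_ W : lmodType R[i] := submodule (Psub W).

Let res_fun W W' (h : W' `<=` W) (s : sect_ W) : sect_ W' :=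
  exist _ (res F h (sval s)) (Pres h (svalP s)).

Let res_fun_linear W W' (h : W' `<=` W) : linear (@res_fun W W' h).
Proof. by move=> a u v; apply: submodule_inj; exact: linearP. Qed.

Definition subpresheaf : presheaf X S.
Proof.
refine (@Presheaf _ _ _ sect_ (fun W W' h => linear_pack (@res_fun_linear W W' h)) _ _).
  by move=> W h s; apply: submodule_inj; exact: res_id.
by move=> W W' W'' h h' h'' s; apply: submodule_inj; exact: res_comp.
Defined.

Lemma subpresheafP : is_sheaf subpresheaf.
Proof.
move=> W T cT s hs.
have hs' : @compatible _ _ _ F T (fun V tV => sval (s V tV)).
  by move=> V1 V2 t1 t2 V h1 h2;
      exact: (congr1 (@submodule_val _ _ _ (Psub V)) (hs V1 V2 t1 t2 V h1 h2)).
have [w [hw wu]] := sheafP cT hs'.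
have Pw : P w.
  by apply: Ploc cT _ => V h tV; rewrite (hw V tV); exact: svalP.
exists (exist _ w Pw); split.
  by move=> V tV h; apply: submodule_inj; exact: hw.
move=> [w' Pw'] h'; apply: submodule_inj; apply: wu => V tV h.
exact: (congr1 (@submodule_val _ _ _ (Psub V)) (h' V tV h)).
Qed.

Definition subsheaf : sheaf X S := Sheaf subpresheafP.

Definition subsheaf_incl : sheafMor subsheaf F.
Proof.
refine (@SheafMor _ _ _ subsheaf F (fun W => linear_pack (@submodule_val_linear _ _ _
    (Psub W))) _).
by [].
Defined.

Section Lift.
Variables (H : sheaf X S) (f : sheafMor H F) (hf : forall W s, P (f W s)).

Let lift_fun W (s : H W) : subsheaf W := exist _ (f W s) (hf s).

Let lift_linear W : linear (@lift_fun W).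
Proof. by move=> a u v; apply: submodule_inj; exact: linearP. Qed.

Definition subsheaf_lift : sheafMor H subsheaf.
Proof.
refine (@SheafMor _ _ _ H subsheaf (fun W => linear_pack (@lift_linear W)) _).
by move=> W W' h s; apply: submodule_inj; exact: mor_natural.
Defined.

End Lift.
End Subsheaf.

Lemma id_fun_linear (M : lmodType R[i]) : linear (fun x : M => x).
Proof. by []. Qed.

Definition mor_id F : sheafMor F F.
Proof.
by refine (@SheafMor _ _ _ F F (fun W => linear_pack (@id_fun_linear (F W))) _).
Defined.

Lemma comp_fun_linear (M N Q : lmodType R[i]) (u : {linear M -> N})
  (v : {linear N -> Q}) : linear (fun x => v (u x)).
Proof. by move=> a x y; rewrite !linearP. Qed.

Definition mor_comp F G H (g : sheafMor G H) (f : sheafMor F G) : sheafMor F H.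
Proof.
refine (@SheafMor _ _ _ F H (fun W => linear_pack (comp_fun_linear (f W) (g W))) _).
by move=> W W' h s /=; rewrite !mor_natural.
Defined.

End SheafBasics.

(** * Short exact sequences *)

Section ShortExact.
Variables (R : realType) (X S : analyticManifold R).
Variables (F' F F'' : sheaf X S) (f : sheafMor F' F) (g : sheafMor F F'').
Hypothesis fg : short_exact f g.

Definition ker_pred (G H : sheaf X S) (h : sheafMor G H) W (s : G W) : Prop :=
  h W s = 0.

Lemma ker_submodule (G H : sheaf X S) (h : sheafMor G H) W :
  submodule_pred (@ker_pred G H h W).
Proof.
split=> [|a x y]; rewrite /ker_pred ?linear0 // => hx hy.
by rewrite linearP hx hy scaler0 addr0.
Qed.

Lemma ker_res (G H : sheaf X S) (h : sheafMor G H) (W W' : op X S)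
    (i : W' `<=` W) (s : G W) : ker_pred h s -> ker_pred h (res G i s).
Proof. by rewrite /ker_pred mor_natural => ->; rewrite linear0. Qed.

Lemma ker_loc (G H : sheaf X S) (h : sheafMor G H) (W : op X S) T (w : G W) :
  covering T W -> (forall (V : op X S) (i : V `<=` W), T V -> ker_pred h (res G i w)) ->
  ker_pred h w.
Proof.
move=> cT hw; apply: (sheaf_eq0 cT) => V i tV.
by rewrite -mor_natural; exact: hw.
Qed.

Definition ker_sheaf : sheaf X S :=
  @subsheaf R X S F (@ker_pred F F'' g) (@ker_submodule F F'' g)
    (@ker_res F F'' g) (@ker_loc F F'' g).

(** The inclusion of [ker_sheaf] factors through [f], which gives preimages. By uniqueness, the
    factorization of [f] through itself is the identity of [F'], and it passes through [ker_sheaf],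
    whence injectivity. *)
Lemma short_exact_ker : (forall W s, g W s = 0 -> exists s', f W s' = s) /\
  (forall W, injective (f W)).
Proof.
have [[fg0 hk] _] := fg.
pose incl : sheafMor ker_sheaf F := subsheaf_incl _ _ _.
have [k [hkk _]] := hk ker_sheaf incl (fun W s => svalP s).
split=> [W s gs|W x y fxy].
  by exists (k W (exist _ s gs)); rewrite hkk.
pose l : sheafMor F' ker_sheaf := subsheaf_lift _ _ _ (f := f) fg0.
have [k0 [_ k0u]] := hk F' f fg0.
have E s : s = k W (l W s).
  rewrite -[LHS]/(mor_id F' W s) -[RHS]/(mor_comp k l W s).
  rewrite -(k0u (mor_id F')) // -(k0u (mor_comp k l)) // => W' s'.
  exact: hkk.
by rewrite (E x) (E y); congr (k W _); exact: submodule_inj.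
Qed.

(* Local images are tested at points because the coverings of the site are not
   transitive: coverings of the pieces U x V_j by products cannot in general be
   refined by a single product covering. *)
Definition loc_im (W : op X S) (s : F'' W) : Prop :=
  forall p, pin p W -> exists (V : op X S) (h : V `<=` W) (t : F V),
    pin p V /\ g V t = res F'' h s.

Lemma loc_im_submodule W : submodule_pred (@loc_im W).
Proof.
split=> [p pW|a x y hx hy p pW].
  by exists W, (@subset_refl _ _), 0; rewrite !linear0.
have [V [h [t [pV ht]]]] := hx p pW; have [V' [h' [t' [pV' ht']]]] := hy p pW.
have hl : opI V V' `<=` V by move=> q [].
have hr : opI V V' `<=` V' by move=> q [].
exists (opI V V'), (subset_trans hl h), (a *: res F hl t + res F hr t').
split; first exact: pinI.
rewrite !linearP !mor_natural ht ht'.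
by rewrite (res_comp h hl (subset_trans hl h)) (res_comp h' hr (subset_trans hl h)).
Qed.

Lemma loc_im_res (W W' : op X S) (i : W' `<=` W) (s : F'' W) :
  loc_im s -> loc_im (res F'' i s).
Proof.
move=> hs p pW'; have [V [h [t [pV ht]]]] := hs p (pin_sub i pW').
have hl : opI V W' `<=` V by move=> q [].
have hr : opI V W' `<=` W' by move=> q [].
exists (opI V W'), hr, (res F hl t); split; first exact: pinI.
by rewrite mor_natural ht (res_comp _ _ (subset_trans hr i)) (res_comp _ _
    (subset_trans hr i)).
Qed.

Lemma loc_im_loc W T (w : F'' W) : covering T W ->
  (forall (V : op X S) (i : V `<=` W), T V -> loc_im (res F'' i w)) -> loc_im w.
Proof.
move=> cT hw p pW; have [t Tt pt] := pin_covering (op_site_open W) cT pW.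
have [/(_ _ Tt) [ot tW] _] := cT.
have [V [h [u [pV hu]]]] := hw (Op ot) tW Tt p pt.
exists V, (subset_trans h tW), u; split=> //.
by rewrite hu; exact: res_comp.
Qed.

Definition im_sheaf : sheaf X S :=
  subsheaf loc_im_submodule loc_im_res loc_im_loc.

(** The map [g] factors through [im_sheaf]. The resulting endomorphism of [F''] agrees with the
    identity after [g], so uniqueness in the cokernel property makes them equal, and every section
    comes from [im_sheaf]. *)
Lemma short_exact_loc_surj W (s : F'' W) : loc_im s.
Proof.
have [[fg0 _] [_ hc]] := fg.
have hg W' (t : F W') : loc_im (g W' t).
  by move=> p pW; exists W', (@subset_refl _ _), t; rewrite res_id.
pose l : sheafMor F im_sheaf := subsheaf_lift _ _ _ (f := g) hg.
have l0 : zero_comp f l.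
  by move=> W' t; apply: submodule_inj; exact: fg0.
have [k [hk _]] := hc im_sheaf l l0.
have [k0 [_ k0u]] := hc F'' g fg0.
pose incl : sheafMor im_sheaf F'' := subsheaf_incl _ _ _.
suff -> : s = incl W (k W s) by exact: svalP.
rewrite -[LHS]/(mor_id F'' W s) -[RHS]/(mor_comp incl k W s).
rewrite -(k0u (mor_id F'')) // -(k0u (mor_comp incl k)) // => W' s'.
by rewrite -[LHS]/(incl W' (k W' (g W' s'))) hk.
Qed.

Lemma short_exact_zero W s : g W (f W s) = 0.
Proof. by case: fg => -[h _] _. Qed.

(** Only the rectangles of [t] over [v] meet the slice; [B] is chosen with closure inside all their
    second factors. *)
Lemma way_below_slice (t : set (X * S)) (A : set X) (v : S) :
  site_open t -> rc_op_sa A -> exists B, [/\ open B, B v &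
    way_below ([set x | A x /\ t (x, v)] `*` B) t].
Proof.
move=> /site_openP [E [fE hE tE]] rA.
pose Ev := [set e | E e /\ e.2 v].
have fEv : finite_set Ev by apply: sub_finite_set fE => e [].
have nO : nbhs v (\bigcap_(e in Ev) e.2).
  apply: open_nbhs_nbhs; split; last by move=> e [].
  by apply: open_finite_bigcap => // e [/hE []].
have [B [[[oB _] cB] Bv hB]] := rc_op_sa_nbhs nO.
exists B; split=> //; exists [set (A `&` e.1, B) | e in Ev]; split.
- exact: finite_image.
- move=> _ [e [Ee ev] <-]; have [e1 _] := hE e Ee; split=> //=.
    exact: rc_op_saI.
  move=> [x w] [/= [_ ex] /hB hw]; rewrite tE; exists e => //.
  by split=> //; apply: hw.
- move=> [x w] [/= [Ax]]; rewrite tE => -[e Ee [ex ev]] Bw.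
  by exists (A `&` e.1, B) => //; exists e.
Qed.

(** The empty family covers the empty set. *)
Lemma site_open_sect0 (G : sheaf X S) (W : op X S) (a b : G W) :
  W = set0 :> set _ -> a = b.
Proof.
move=> W0; have c0 : covering (range (fun i : void => op_set (match i with end : op X
    S))) W.
  have E : range (fun i : void => op_set (match i with end : op X S)) = set0.
    by rewrite -subset0 => t [[]].
  rewrite E W0 -(bigcup_set0 (fun t : set (X * S) => t)).
  by apply: covering_finite.
by apply: (sheaf_sep c0) => -[].
Qed.

Lemma covering2 (W W' : op X S) :
  covering (range (fun i : bool => op_set (if i then W else W'))) (opU W W').
Proof.
set O := fun i : bool => _.
have -> : (opU W W' : set _) = \bigcup_(t in range O) t.
  rewrite bigcup_image; apply/seteqP; split=> [q [Wq|W'q]|q [[] _ ?]].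
  - by exists true.
  - by exists false.
  - by left.
  - by right.
apply: covering_finite; first exact: finite_image.
by move=> _ [[] _ <-]; exact: op_site_open.
Qed.

Lemma sheaf_glue2 (G : sheaf X S) (W W' : op X S) (a : G W) (b : G W')
    (h : opI W W' `<=` W) (h' : opI W W' `<=` W') :
  res G h a = res G h' b ->
  exists w : G (opU W W'), forall (i : W `<=` opU W W') (i' : W' `<=` opU W W'),
    res G i w = a /\ res G i' w = b.
Proof.
move=> ab; pose O (i : bool) := if i then W else W'.
pose c i : G (O i) := match i with true => a | false => b end.
have [|w hw] := @sheaf_glue _ _ _ G _ O (opU W W') (covering2 W W') c.
  have E : opI W' W = opI W W' by apply: op_eq; rewrite /= setIC.
  have E' : forall (V : op X S) (i : V `<=` W) (i' : V `<=` W'), V = opI W W' ->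
    res G i a = res G i' b.
    move=> V i i' VE; subst V.
    by rewrite (res_eq i h) ab (res_eq h' i').
  case=> -[] i j.
  - exact: res_eq.
  - exact: E'.
  - by symmetry; exact: E'.
  - exact: res_eq.
by exists w => i i'; split; [exact: (hw true)|exact: (hw false)].
Qed.

Lemma sheaf_sep2 (G : sheaf X S) (W W' : op X S) (a b : G (opU W W'))
    (i : W `<=` opU W W') (i' : W' `<=` opU W W') :
  res G i a = res G i b -> res G i' a = res G i' b -> a = b.
Proof.
move=> e e'.
apply: (sheaf_sep (covering2 W W')) => -[] h.
  by rewrite (res_eq h i) e; exact: res_eq.
by rewrite (res_eq h i') e'; exact: res_eq.
Qed.

(** * Lifting near weakly quasi-compact sets *)

Section LiftNear.
Hypothesis sF' : c_soft F'.
Variables (Y : op X S) (s'' : F'' Y).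

Definition lift_on (U : op X S) : Prop :=
  exists (h : U `<=` Y) (t : F U), g U t = res F'' h s''.

Definition lift_near (K : set (X * S)) : Prop :=
  exists U : op X S, lift_on U /\ way_below K U.

Lemma lift_near_le K K' : K `<=` K' -> lift_near K' -> lift_near K.
Proof.
by move=> sK [U [lU hU]]; exists U; split=> //; exact: way_below_le sK _ hU.
Qed.

Lemma lift_near0 : lift_near set0.
Proof.
exists (Op (@site_open0 _ X S)); split; last exact: way_below0.
by exists (@sub0set _ _), 0; exact: site_open_sect0.
Qed.

Lemma lift_nearU K1 K2 : lift_near K1 -> lift_near K2 -> lift_near (K1 `|` K2).
Proof.
move=> [U1 [[h1 [s1 hs1]] K1U]] [U2 [[h2 [s2 hs2]] K2U]].
have [L1' [oL1 K1L L1U]] := way_below_interpolate (op_site_open U1) K1U.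
have [L2' [oL2 K2L L2U']] := way_below_interpolate (op_site_open U2) K2U.
(* In the c-softness of [F'], [V] is the intersection of [L1] and [L2], [W] is [M] and [Y] is [U2]:
   the intermediate [M] makes the extended section available on all of [L2], where it corrects
   [s2]. *)
have [M' [oM L2M M2U]] := way_below_interpolate (op_site_open U2) L2U'.
pose L1 := Op oL1; pose L2 := Op oL2; pose M := Op oM.
have hl : opI U1 U2 `<=` U1 by move=> q [].
have hr : opI U1 U2 `<=` U2 by move=> q [].
have [r hrr] : exists r, f (opI U1 U2) r = res F hl s1 - res F hr s2.
  apply: short_exact_ker.1; rewrite linearB !mor_natural hs1 hs2.
  by rewrite !(res_comp _ _ (subset_trans hl h1)) subrr.
have wV : wc (opI L1 L2) M.
  by apply/wcP; apply: way_below_le L2M => // q [].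
have wVU : wc (opI L1 L2) (opI U1 U2) by apply/wcP; exact: way_belowI.
have wMY : wc M U2 by apply/wcP.
have wVY : wc (opI L1 L2) U2.
  by apply/wcP; apply: way_below_le L2U' => // q [].
have [r' [U3 [hM [hI [wU3 Er]]]]] :=
  sF' wVY.1 wMY.1 wVY wMY wV r wVU.
have L1U1 : L1 `<=` U1 := way_below_sub L1U.
have L2M' : L2 `<=` M := way_below_sub L2M.
have MU2 : M `<=` U2 := way_below_sub M2U.
have L2U2 : L2 `<=` U2 := subset_trans L2M' MU2.
pose a := res F L1U1 s1.
pose b := res F L2U2 s2 + res F L2M' (f M r').
have hL1 : opI L1 L2 `<=` L1 by move=> q [].
have hL2 : opI L1 L2 `<=` L2 by move=> q [].
have ab : res F hL1 a = res F hL2 b.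
  have hU3 : opI L1 L2 `<=` U3 := wU3.1.
  have k1 := subset_trans hL1 L1U1; have k2 := subset_trans hL2 L2U2.
  have kM := subset_trans hL2 L2M'; have kI := subset_trans hU3 hI.
  have := congr1 (fun x => res F hU3 (f U3 x)) Er.
  rewrite /= !mor_natural hrr !linearB /= (res_comp hM hU3 kM) !(res_comp hI hU3 kI).
  rewrite (res_comp hl kI k1) (res_comp hr kI k2) => E.
  rewrite /a /b linearD /= (res_comp L1U1 hL1 k1) (res_comp L2U2 hL2 k2).
  by rewrite (res_comp L2M' hL2 kM) E addrCA subrr addr0.
have [w hw] := sheaf_glue2 ab.
exists (opU L1 L2); split; last exact: way_belowU.
have i1 : L1 `<=` opU L1 L2 by move=> q; left.
have i2 : L2 `<=` opU L1 L2 by move=> q; right.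
have hY : opU L1 L2 `<=` Y by move=> q [/L1U1/h1|/L2U2/h2].
exists hY, w; have [w1 w2] := hw i1 i2.
apply: (@sheaf_sep2 _ _ _ _ _ i1 i2); rewrite -mor_natural.
  rewrite w1 /a mor_natural hs1 !(res_comp _ _ (subset_trans L1U1 h1)).
  by [].
rewrite w2 /b linearD !mor_natural hs2.
rewrite short_exact_zero linear0 addr0 !(res_comp _ _ (subset_trans L2U2 h2)).
by [].
Qed.

Lemma lift_near_bigcup (I : eqType) (D : set I) (K : I -> set (X * S)) :
  finite_set D -> (forall i, D i -> lift_near (K i)) ->
  lift_near (\bigcup_(i in D) K i).
Proof.
move: D; apply: finite_set_ind => [|i D fD IH] h.
  by rewrite bigcup_set0; exact: lift_near0.
rewrite bigcup_setU1; apply: lift_nearU; first by apply: h; left.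
by apply: IH => j Dj; apply: h; right.
Qed.

(** On a rectangle [A x B], the points over a fixed [v] give finitely many opens with lifts that
    cover [A x {v}]. Each slice lifts over a neighbourhood of [v], so their union gives a strip
    [A x Q] near which a lift exists, and finitely many such [Q] cover [closure B]. *)
Lemma way_below_lift_near K : way_below K Y -> lift_near K.
Proof.
move=> [D [fD hD KD]]; apply: lift_near_le KD _.
apply: lift_near_bigcup => // -[A B] /hD [/= rA oB cB ABY].
pose C := [set Q | open Q /\ lift_near (A `*` Q)].
have [||E [fE sE hE]] := @compact_finite_subcover S _ C cB.
- by move=> Q [].
- move=> v cBv.
  have [|T0 [fT sT hT]] := @points_finite_cover R X S A v
      [set t : set (X * S) | exists2 U : op X S, t = op_set U & lift_on U] rA.2.
    move=> p pv pA; have pY : pin p Y.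
      rewrite /pin pv; have ? := pt_ultraP p; apply: filterS pA => x Ax.
      by apply: ABY.
    have [V [h [t [pV ht]]]] := short_exact_loc_surj s'' pY.
    by exists V => //; exists V => //; exists h, t.
  have /choice [Q hQ] : forall t, exists Q, T0 t -> [/\ open Q, Q v &
      lift_near ([set x | A x /\ t (x, v)] `*` Q)].
    move=> t; have [/sT [U -> lU]|nT] := pselect (T0 t); last by exists set0.
    have [Q [oQ Qv hQ]] := way_below_slice v (op_site_open U) rA.
    by exists Q => _; split=> //; exists U.
  exists (\bigcap_(t in T0) Q t); last by move=> t /hQ [].
  split; first by apply: open_finite_bigcap => // t /hQ [].
  apply: (@lift_near_le _ (\bigcup_(t in T0) ([set x | A x /\ t (x, v)] `*` Q t))).
    move=> [x w] [/= Ax Qw]; have [t Tt tx] := hT x Ax.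
    by exists t => //; split=> //=; exact: Qw.
  by apply: lift_near_bigcup => // t /hQ [].
apply: (@lift_near_le _ (\bigcup_(Q in E) (A `*` Q))).
  move=> [x w] [/= Ax Bw]; have [Q EQ Qw] := hE w (subset_closure Bw).
  by exists Q.
by apply: lift_near_bigcup => // Q /sE [].
Qed.

End LiftNear.

(** It is the lift that gets extended, by c-softness of [F]; [g] then carries the extension back to
    [F'']. *)
Lemma c_soft_cokernel : c_soft F' -> c_soft F -> c_soft F''.
Proof.
move=> sF' sF V W Y VY WY wVY wWY wVW U t wVU.
have [U' [[h [s hs]] VU']] := way_below_lift_near sF' t ((wcP _ _).1 wVU).
have [s' [U2 [h2 [h2' [wU2 E]]]]] := sF V W Y VY WY wVY wWY wVW U' s ((wcP _ _).2 VU').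
exists (g W s'), U2, h2, (subset_trans h2' h); split=> //.
rewrite -mor_natural E mor_natural hs.
exact: res_comp.
Qed.

End ShortExact.

(** * Exhaustion of a product and lifting over it *)

Section GlobalLift.
Variables (R : realType) (X S : analyticManifold R).

(** The sets [N i] cover X and not only [U]: this makes the traces [U ∩ N i] a covering in X_sa, and
    [way_below] asks that they be relatively compact in X, not in [U]. The interpolation at stage
    [n] absorbs the [n]-th rectangle [P n] into [W n.+1]. *)
Lemma exhaustion (U : set X) (V : set S) (hU : op_sa U) (hV : open V) :
  exists W : nat -> op X S,
    [/\ forall n, way_below (W n) (W n.+1),
        forall n, way_below (W n) (op_prod hU hV) &
        covering (range (fun n => op_set (W n))) (op_prod hU hV)].
Proof.
have [N [hN NE]] := countable_rc_cover (@openT X).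
have [M [hM ME]] := countable_rc_cover hV.
pose UV := op_prod hU hV.
(* A number that codes no pair contributes the empty set. *)
pose P n : set (X * S) := if @choice.unpickle (nat * nat)%type n is Some (i, j) then (U
    `&` N i) `*` M j else set0.
have hP n : way_below (P n) UV.
  rewrite /P; case: choice.unpickle => [[i j]|]; last exact: way_below0.
  exists [set (U `&` N i, M j)]; split=> //; last by move=> q h; exists (U `&` N i, M j).
  move=> _ -> /=; have [[rN _] [[[oM _] cM] MV]] := (hN i, hM j); split=> //.
    by rewrite setIC; exact: rc_op_saI.
  by move=> [x v] [/= [Ux _] /MV].
have step (n : nat) (W : op X S) : exists W' : op X S, way_below W UV ->
    [/\ way_below W W', P n `<=` W' & way_below W' UV].
  have [hW|nW] := pselect (way_below W UV); last by exists W.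
  have := way_belowU hW (hP n); rewrite setUid => hWP.
  have [W' [oW' h1 h2]] := way_below_interpolate (op_site_open UV) hWP.
  exists (Op oW') => _; split=> //.
    by apply: way_below_le h1 => // q; left.
  by move=> q Pq; apply: (way_below_sub h1); right.
pose nxt n := projT1 (choice (step n)).
have hnxt n := projT2 (choice (step n)).
pose W := fix W n := if n is m.+1 then nxt m (W m) else Op (@site_open0 _ X S).
have hW n : way_below (W n) UV.
  elim: n => [|n IH]; first exact: way_below0.
  by have [] := hnxt n _ IH.
exists W; split=> // [n|]; first by have [] := hnxt n _ (hW n).
apply/coveringP; split=> [_ [n _ <-]|U' V' oU' oV' UV'].
  by split; [exact: op_site_open|exact: way_below_sub].
(* For empty [U'], nothing forces [V'] into [V]; the empty family then covers [U']. *)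
have [U'0|/set0P [x U'x]] := eqVneq U' set0.
  exists set0, [set V']; split.
  - by split=> // K _; exists set0; split=> //; rewrite U'0 bigcup_set0.
  - by split=> [_ ->|] //; rewrite bigcup_set1.
  - by move=> ? [A []].
exists [set U' `&` A | A in range N], [set V' `&` M j | j in setT]; split.
- apply: sa_covering_cap => // [_ [i _ <-]|y]; first by have [[]] := hN i.
  have [i _ Nx] : (\bigcup_i N i) y by rewrite -NE.
  by exists (N i) => //; exists i.
- split=> [_ [j _ <-]|]; first by apply: openI => //; have [[[]]] := hM j.
  apply/seteqP; split=> [v [_ [j _ <-] []]//|v V'v].
  have [_ Vv] := UV' (x, v) (conj U'x V'v).
  by move: Vv; rewrite /= ME => -[j _ Mv]; exists (V' `&` M j); [exists j|].
- move=> ? [_ [_ [i _ <-] <-] [_ [j _ <-] <-]].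
  exists (W (choice.pickle (i, j)).+1); first by exists (choice.pickle (i, j)).+1.
  move=> [y v] [/= [U'y Ny] [V'v Mv]].
  have [_ h _] := hnxt (choice.pickle (i, j)) _ (hW (choice.pickle (i, j)));
      apply: (h (y, v)); rewrite /P choice.pickleK.
  by have [Uy _] := UV' (y, v) (conj U'y V'v).
Qed.

Variables (F' F F'' : sheaf X S) (f : sheafMor F' F) (g : sheafMor F F'').
Hypotheses (fg : short_exact f g) (sF' : c_soft F').

(* Mittag-Leffler: a lift near W n is corrected by a section of F' so as to
   agree on W n with a lift over W n.+2. *)
Lemma surj_exhausted (Y : op X S) (W : nat -> op X S) :
  (forall n, way_below (W n) (W n.+1)) -> (forall n, way_below (W n) Y) ->
  covering (range (fun n => op_set (W n))) Y ->
  forall s'' : F'' Y, exists s : F Y, g Y s = s''.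
Proof.
move=> hW hWY cW s''.
have WY n : W n `<=` Y := way_below_sub (hWY n).
have WS n : W n `<=` W n.+1 := way_below_sub (hW n).
have lift n : exists s : F (W n), g _ s = res F'' (WY n) s''.
  have [U [[h [t ht]] /way_below_sub WU]] := way_below_lift_near fg sF' s'' (hWY n).
  by exists (res F WU t); rewrite mor_natural ht (res_comp h WU (WY n)).
(* A lift over [W n.+1] agrees with the next one only over [W n]; hence this shift, and the
   restrictions to [W n] that form the coherent family [u]. *)
pose L n := {s : F (W n.+1) | g _ s = res F'' (WY n.+1) s''}.
have step n (x : L n) : {y : L n.+1 |
    res F (subset_trans (WS n) (WS n.+1)) (sval y) = res F (WS n) (sval x)}.
  apply: cid; case: x => s hs; have [s1 hs1] := lift n.+2.
  have [r hr] : exists r, f (W n.+1) r = s - res F (WS n.+1) s1.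
    apply: (short_exact_ker fg).1.
    by rewrite linearB mor_natural hs hs1 (res_comp _ _ (WY n.+1)) subrr.
  have wVU : wc (W n) (W n.+1) by apply/wcP.
  have wWY : wc (W n.+2) (W n.+3) by apply/wcP.
  have wVW : wc (W n) (W n.+2).
    by apply/wcP; apply: way_below_le (hW n) => //; exact: WS.
  have wVY : wc (W n) (W n.+3).
    by apply/wcP; apply: way_below_le ((wcP _ _).1 wVW) => //; exact: WS.
  (* The ambient open set is [W n.+3], because the correction [r'] is needed on all of [W n.+2]. *)
  have [r' [U [hU [hU' [wU E]]]]] := sF' wVY.1 wWY.1 wVY wWY wVW r wVU.
  have gy : g (W n.+2) (s1 + f (W n.+2) r') = res F'' (WY n.+2) s''.
    by rewrite linearD (short_exact_zero fg) addr0.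
  exists (exist _ (s1 + f _ r') gy); rewrite /=.
  have := congr1 (fun x => res F wU.1 (f U x)) E.
  rewrite /= !mor_natural hr linearB /= linearB /=.
  rewrite (res_comp hU wU.1 (subset_trans (WS n) (WS n.+1))).
  rewrite (res_comp hU' wU.1 (WS n)) => E'.
  rewrite linearD /= E'.
  have k : U `<=` W n.+2 := subset_trans hU' (WS n.+1).
  rewrite (res_comp (WS n.+1) hU' k) (res_comp k wU.1 (subset_trans (WS n) (WS n.+1))).
  by rewrite addrCA subrr addr0.
have [s0 hs0] := lift 1%N.
pose x := fix x n : L n := if n is m.+1 then sval (step m (x m)) else exist _ s0 hs0.
pose u n := res F (WS n) (sval (x n)).
have uS n : res F (WS n) (u n.+1) = u n.
  rewrite /u /=; case: (step n (x n)) => y /= <-.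
  by rewrite (res_comp _ _ (subset_trans (WS n) (WS n.+1))).
have ule i j (h : W i `<=` W j) : (i <= j)%N -> res F h (u j) = u i.
  elim: j h => [|j IH] h.
    by rewrite leqn0 => /eqP i0; subst i; rewrite res_id.
  rewrite leq_eqVlt => /predU1P [ij|]; first by subst i; rewrite res_id.
  rewrite ltnS => ij; have hij : W i `<=` W j.
    elim: j ij {IH h} => [|j IH]; first by rewrite leqn0 => /eqP ->.
    rewrite leq_eqVlt => /predU1P [->//|]; rewrite ltnS => /IH h.
    exact: subset_trans h (WS j).
  by rewrite -(IH hij ij) -(uS j) (res_comp _ _ h).
have gu n : g _ (u n) = res F'' (WY n) s''.
  by rewrite /u mor_natural (svalP (x n)) (res_comp _ _ (WY n)).
have [|s hs] := sheaf_glue cW (a := u).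
  move=> i j h h'; wlog ij : i j h h' / (i <= j)%N => [hw|].
    have [ij|ji] := leqP i j; first exact: hw.
    have E : opI (W i) (W j) = opI (W j) (W i) by apply: op_eq; rewrite /= setIC.
    move: h h'; rewrite E => h h'; symmetry; apply: hw; exact: ltnW.
  have hij : W i `<=` W j.
    elim: j ij {h h'} => [|j IH]; first by rewrite leqn0 => /eqP ->.
    rewrite leq_eqVlt => /predU1P [->//|]; rewrite ltnS => /IH h.
    exact: subset_trans h (WS j).
  by rewrite -(ule i j hij ij) (res_comp hij h h').
exists s; apply: (sheaf_sep cW) => n h.
by rewrite -mor_natural hs gu; exact: res_eq.
Qed.

Lemma short_exact_Gamma (U : set X) (V : set S) (hU : op_sa U) (hV : open V) :
  lmod_short_exact (GammaM (op_prod hU hV) f) (GammaM (op_prod hU hV) g).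
Proof.
have [kfg finj] := short_exact_ker fg.
split; first exact: finj.
  apply/seteqP; split=> [_ [s _ <-]|s /kfg [s' <-]]; first exact: (short_exact_zero fg).
  by exists s'.
apply/seteqP; split=> // s'' _; have [W [h1 h2 h3]] := exhaustion hU hV.
by have [s hs] := surj_exhausted h1 h2 h3 s''; exists s.
Qed.

End GlobalLift.

(** * The product of the stalks *)

Section Stalks.
Variables (R : realType) (X S : analyticManifold R) (F : sheaf X S).
Implicit Types (W V : op X S) (p : site_point X S).

(* The stalk at p is the product of all F W, modulo the families that vanish
   on all small enough W containing p. *)
Definition null_germ p (a : prod_module (fun W : op X S => F W)) : Prop :=
  forall V : op X S, pin p V -> exists W0 : op X S, [/\ W0 `<=` V, pin p W0 &
    forall W : op X S, W `<=` W0 -> pin p W -> a W = 0].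

Lemma null_germ_submodule p : submodule_pred (null_germ p).
Proof.
split=> [V pV|k a b ha hb V pV]; first by exists V; split.
have [W1 [W1V p1 h1]] := ha V pV; have [W2 [W21 p2 h2]] := hb W1 p1.
exists W2; split=> // [|W W2W pW]; first exact: subset_trans W21 W1V.
rewrite -[LHS]/(k *: a W + b W) h1 //; last exact: subset_trans W21.
by rewrite h2 // scaler0 addr0.
Qed.

Definition stalk p : lmodType R[i] := quotient_module (null_germ_submodule p).

(** The value 0 on opens not contained in [W] does not affect germs at points of [W], which depend
    on small opens only. *)
Definition restrictions W (s : F W) : prod_module (fun W : op X S => F W) :=
  fun W' => match pselect (W' `<=` W) with left h => res F h s | right _ => 0 end.

Definition germ p W (s : F W) : stalk p :=
  quotient_pi (null_germ_submodule p) (restrictions s).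

Lemma germ_linear p W : linear (@germ p W).
Proof.
move=> k s t; rewrite /germ -quotient_pi_linear; congr quotient_pi.
apply: prod_module_ext => W'; rewrite -[RHS]/(k *: restrictions s W' + restrictions t W').
rewrite /restrictions; case: pselect => h; first by rewrite linearP.
by rewrite scaler0 addr0.
Qed.

Lemma germ_res p W W' (h : W' `<=` W) (s : F W) : pin p W' ->
  germ p (res F h s) = germ p s.
Proof.
move=> pW'; apply/quotient_piP => V pV; exists (opI V W'); split.
- by move=> q [].
- exact: pinI.
- move=> W0 W0V _; have W0W' : W0 `<=` W' by move=> q /W0V [].
  have W0W := subset_trans W0W' h.
  rewrite -[LHS]/(restrictions (res F h s) W0 - restrictions s W0) /restrictions.
  case: pselect => [h1|//]; case: pselect => [h2|//].
  by rewrite (res_comp h h1 h2) subrr.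
Qed.

(** The quotient may be larger than the usual colimit, but it detects zero in the same way: the
    family of restrictions is evaluated at the small open set itself. *)
Lemma germ_eq0 p W (s : F W) : pin p W -> germ p s = 0 ->
  exists (V : op X S) (h : V `<=` W), pin p V /\ res F h s = 0.
Proof.
move=> pW /quotient_piP /(_ W pW) [V [VW pV hV]]; exists V, VW; split=> //.
have := hV V (@subset_refl _ _) pV; rewrite -[LHS]/(restrictions s V - 0) subr0.
rewrite /restrictions; case: pselect => [h <-|//]; exact: res_eq.
Qed.

(** Two successive coverings are used, each with its own appeal to separatedness. Inside a rectangle
    [A x B] with [A] relatively compact, finitely many opens where [s] vanishes cover [A x {v}],
    hence a strip [A x B']. Strips keep the full factor [A], so they are refined by a product
    covering with the single first factor [U]. *)
Lemma germ_sep W (s : F W) : (forall p, pin p W -> germ p s = 0) -> s = 0.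
Proof.
move=> hs.
pose T1 := [set t : set (X * S) | exists A B, [/\ rc_op_sa A, open B,
  A `*` B `<=` W & t = A `*` B]].
have c1 : covering T1 W.
  apply/coveringP; split=> [_ [A [B [[oA _] oB sW ->]]]|U O oU oO UO].
    by split=> //; exact: site_open_prod.
  exists [set U `&` N | N in rc_op_sa (X := X)], [set O]; split.
  - exact: sa_covering_rc.
  - by split=> [_ ->//|]; rewrite bigcup_set1.
  - move=> _ [_ [N rN <-] [_ -> <-]]; exists ((U `&` N) `*` O) => //.
    exists (U `&` N), O; split=> //; first by rewrite setIC; exact: rc_op_saI.
    by move=> [x v] [/= [Ux _] Ov]; exact: UO.
apply: (sheaf_eq0 c1) => V VW [A [B [rA oB ABW VE]]].
(* A member of [T2] is a bare set; vanishing is asked on every [op] inside it, so that no section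
   has to be transported. *)
pose T2 := [set t : set (X * S) | exists B', [/\ open B', B' `<=` B,
  t = A `*` B' & forall (V' : op X S) (h : V' `<=` W), V' `<=` t -> res F h s = 0]].
have c2 : covering T2 V.
  apply/coveringP; split=> [_ [B' [oB' B'B -> _]]|U O oU oO UO].
    split; first by apply: site_open_prod => //; case: rA.
    by rewrite VE => -[x v] [/= ? /B'B ?].
  (* If [U] is empty, [O] need not lie in [B]. *)
  have [U0|/set0P [x0 Ux0]] := eqVneq U set0.
    exists set0, [set O]; split.
    - by split=> // K _; exists set0; split=> //; rewrite U0 bigcup_set0.
    - by split=> [_ ->|] //; rewrite bigcup_set1.
    - by move=> ? [A' []].
  exists [set U], [set B' | B' `<=` O /\ T2 (A `*` B') /\ open B']; split.
  - split=> [_ ->|K _]; first by split.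
    by exists [set U]; split=> //; rewrite bigcup_set1.
  - split=> [B' [_ []] //|]; apply/seteqP; split=> [v [B' [B'O _]] /B'O //|v Ov].
    have OB : O `<=` B.
      move=> w Ow; have : op_set V (x0, w) by apply: UO; split.
      by rewrite VE => -[].
    have UA : U `<=` A.
      move=> x Ux; have : op_set V (x, v) by apply: UO; split.
      by rewrite VE => -[].
    have [|T0 [fT sT hT]] := @points_finite_cover R X S A v
       [set t : set (X * S) | exists (V' : op X S) (h : V' `<=` W), t = V' /\ res F h s
           = 0] rA.2.
      move=> p pv pA; have pW : pin p W.
        rewrite /pin pv; have ? := pt_ultraP p; apply: filterS pA => x Ax.
        by apply: ABW; split=> //; exact: OB.
      have [V' [h [pV' sV']]] := germ_eq0 pW (hs p pW).
      by exists V' => //; exists V', h.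
    pose Q := \bigcup_(t in T0) t.
    have oT0 : forall t, T0 t -> site_open t.
      by move=> t /sT [V' [_ [-> _]]]; exact: op_site_open.
    have [B' [oB' B'v AB']] : exists B', [/\ open B', B' v & A `*` B' `<=` Q].
      by apply: tube => //; exact: site_open_bigcup_set.
    exists (B' `&` O) => //; split; first by move=> w [].
    split; last exact: openI.
    exists (B' `&` O); split=> //; first exact: openI.
      by move=> w [_ /OB].
    move=> V' h V'AB.
    have QW : Op (site_open_bigcup_set fT oT0) `<=` W.
      by move=> q [t /sT [V'' [h'' [-> _]]]]; exact: h''.
    have V'Q : V' `<=` Op (site_open_bigcup_set fT oT0).
      by move=> q /V'AB [q1 [q2 _]]; exact: AB'.
    rewrite -(res_comp QW V'Q h).
    rewrite (_ : res F QW s = 0) ?linear0 //.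
    apply: (@sheaf_eq0 R X S F (Op (site_open_bigcup_set fT oT0)) T0 _ (covering_finite
        fT oT0)) => V1 i /sT [V2 [h2 [E2 r2]]].
    have V12 : V1 = V2 by exact: op_eq.
    by subst V2; rewrite (res_comp QW i h2).
  - move=> ? [_ -> [B' [B'O [hB' _]] <-]]; exists (A `*` B') => //.
    move=> [x v] [/= Ux B'v]; split=> //=.
    have : op_set V (x, v) by apply: UO; split=> //; exact: B'O.
    by rewrite VE => -[].
apply: (sheaf_eq0 c2) => V' i [B' [_ _ V'E hB']].
rewrite (res_comp VW i (subset_trans i VW)); apply: hB'.
by rewrite V'E.
Qed.

End Stalks.

(** * The embedding into the product of stalks *)

Section StalkProduct.
Variables (R : realType) (X S : analyticManifold R) (F : sheaf X S).

Let sect_ (W : op X S) : lmodType R[i] :=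
  prod_module (fun q : {p | pin p W} => stalk F (sval q)).

Let res_fun (W W' : op X S) (h : W' `<=` W) (u : sect_ W) : sect_ W' :=
  fun q => u (exist _ (sval q) (pin_sub h (proj2_sig q))).

Let res_fun_linear (W W' : op X S) (h : W' `<=` W) : linear (@res_fun W W' h).
Proof. by []. Qed.

Definition stalk_product_presheaf : presheaf X S.
Proof.
refine (@Presheaf _ _ _ sect_ (fun W W' h => linear_pack (@res_fun_linear W W' h)) _ _).
  move=> W h s; apply: prod_module_ext => -[p pW].
  change (s (exist _ p (pin_sub h pW)) = s (exist _ p pW)).
  by rewrite (Prop_irrelevance (pin_sub h pW) pW).
move=> W W' W'' h h' h'' s; apply: prod_module_ext => -[p pW].
change (s (exist _ p (pin_sub h (pin_sub h' pW))) = s (exist _ p (pin_sub h'' pW))).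
by rewrite (Prop_irrelevance (pin_sub h (pin_sub h' pW)) (pin_sub h'' pW)).
Defined.

(** Sections are arbitrary functions of the point, so gluing is pointwise; [pin_covering] provides a
    member of [T] at each point, and compatibility over intersections makes the value independent of
    it. *)
Lemma stalk_product_sheafP : is_sheaf stalk_product_presheaf.
Proof.
move=> W T cT s hs.
have exV (q : {p | pin p W}) : exists Vt : {V : op X S | T V}, pin (sval q) (sval Vt).
  case: q => p pW; have [t Tt pt] := pin_covering (op_site_open W) cT pW.
  have [/(_ _ Tt) [ot _] _] := cT.
  by exists (exist _ (Op ot) Tt).
pose w : sect_ W := fun q => let: exist Vt pV := cid (exV q) in
  s (sval Vt) (proj2_sig Vt) (exist _ (sval q) pV).
have sE (V1 V2 : op X S) (t1 : T V1) (t2 : T V2) p (p1 : pin p V1) (p2 : pin p V2) :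
    s V1 t1 (exist _ p p1) = s V2 t2 (exist _ p p2).
  have h1 : opI V1 V2 `<=` V1 by move=> q [].
  have h2 : opI V1 V2 `<=` V2 by move=> q [].
  have pI : pin p (opI V1 V2) by exact: pinI.
  have := congr1 (fun u => u (exist _ p pI)) (hs V1 V2 t1 t2 _ h1 h2).
  rewrite /= /res_fun /=.
  by rewrite (Prop_irrelevance (pin_sub h1 pI) p1) (Prop_irrelevance (pin_sub h2 pI) p2).
exists w; split.
  move=> V tV h; apply: prod_module_ext => -[p pV].
  rewrite -[LHS]/(w (exist _ p (pin_sub h pV))) /w.
  by case: cid => -[V1 t1] p1 /=; exact: sE.
move=> w' hw'; apply: prod_module_ext => -[p pW].
rewrite /w; case: cid => -[V1 t1] p1 /=.
have V1W : V1 `<=` W by have [/(_ _ t1) []] := cT.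
rewrite -(hw' V1 t1 V1W) -[LHS]/(w' (exist _ p (pin_sub V1W p1))).
by rewrite (Prop_irrelevance (pin_sub V1W p1) pW).
Qed.

Definition stalk_product : sheaf X S := Sheaf stalk_product_sheafP.

Let germs (W : op X S) (s : F W) : stalk_product W := fun q => germ (sval q) s.

Let germs_linear (W : op X S) : linear (@germs W).
Proof.
move=> k s t; apply: prod_module_ext => q; exact: germ_linear.
Qed.

Definition to_stalks : sheafMor F stalk_product.
Proof.
refine (@SheafMor _ _ _ F stalk_product (fun W => linear_pack (@germs_linear W)) _).
by move=> W W' h s; apply: prod_module_ext => -[p pW]; exact: germ_res.
Defined.

Lemma to_stalks_monic : mor_monic to_stalks.
Proof.
move=> H a b hab W s; apply/eqP; rewrite -subr_eq0; apply/eqP.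
apply: germ_sep => p pW.
have := congr1 (fun u => u (exist _ p pW)) (hab W s).
rewrite /= /germs /= => E.
rewrite -scaleN1r addrC germ_linear E scaleN1r addNr //.
Qed.

Lemma c_soft_stalk_product : c_soft stalk_product.
Proof.
move=> V W Y VY WY wVY wWY wVW U t wVU.
pose s : stalk_product W := fun q =>
  match pselect (pin (sval q) U) with
  | left pU => t (exist _ (sval q) pU) | right _ => 0 end.
have hl : opI W U `<=` W by move=> q [].
have hr : opI W U `<=` U by move=> q [].
exists s, (opI W U), hl, hr; split.
  apply/wcP; rewrite -[op_set V]setIid; apply: way_belowI; exact/wcP.
apply: prod_module_ext => -[p pI].
rewrite -[LHS]/(s (exist _ p (pin_sub hl pI))) /s /=.
case: pselect => [pU|nU]; last by case: nU; exact: pin_sub hr pI.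
rewrite -[RHS]/(t (exist _ p (pin_sub hr pI))).
by rewrite (Prop_irrelevance pU (pin_sub hr pI)).
Qed.

End StalkProduct.

Theorem proposition3p5 (R : realType) (X S : analyticManifold R)
    (U : set X) (V : set S) (hU : op_sa U) (hV : open V) :
  injective_wrt (@c_soft R X S) (GammaM (op_prod hU hV)).
Proof.
split=> [F|F' F F'' f g fg sF' sF|F' F F'' f g fg sF' _ _].
- exists (stalk_product F), (to_stalks F).
  by split; [exact: c_soft_stalk_product|exact: to_stalks_monic].
- exact: c_soft_cokernel fg sF' sF.
- exact: short_exact_Gamma.
Qed.
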